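(* Let $t\in[1,\infty)$, let $c\ge2$ be an integer and let $\pi=(\pi_0,\dots,\pi_{c-1})\in(0,1)^c$ be a probability vector, i.e. $\sum_{b=0}^{c-1}\pi_b=1$. Let $U_{\pi,t}$ be the set of all $x\in\mathbb{R}$ for which there is a sequence $(p_n/q_n)_{n\in\mathbb{N}}$ of irreducible fractions ($p_n\in\mathbb{Z}$, $q_n\in\mathbb{N}$) such that $q_n\to\infty$, $|x-p_n/q_n|\le q_n^{-2t}$ for all $n$, and $\sigma_{b,\lfloor2\log_cq_n\rfloor}(p_n/q_n)\to\pi_b$ as $n\to\infty$ for all $b\in\{0,\dots,c-1\}$. Let $\alpha=-\sum_{b=0}^{c-1}\pi_b\log_c\pi_b$ and, for $\eta\in(0,1/8)$, let $f_\eta(r)=(-\log r)^{\eta-1/8}$. Then, for each $\eta\in(0,1/8)$, the set $U_{\pi,t}$ contains a set of the class $\mathrm{G}^{h_{\alpha/t,3f_\eta}}(\mathbb{R})$, where $h_{\alpha/t,3f_\eta}(r)=r^{\alpha/t-3f_\eta(r)}$.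
   Context: Digits. Each real $x$ is written $x=x_0+\sum_{p\ge1}x_pc^{-p}$ with $x_0\in\mathbb{Z}$ and digits $x_p\in\{0,\dots,c-1\}$ ($p\in\mathbb{N}$) not eventually constantly equal to $c-1$; for $b\in\{0,\dots,c-1\}$ and $j\in\mathbb{N}$, $\sigma_{b,j}(x)=\frac1j\#\{p\in\{1,\dots,j\}: x_p=b\}$. (In $\sigma_{b,\lfloor2\log_cq_n\rfloor}$ the index is positive for all large $n$.) Gauge functions and large intersection classes in $\mathbb{R}$. $\mathfrak{D}_1$ is the set of all functions $h$ that vanish at zero, are continuous and nondecreasing on $[0,\varepsilon]$ and are such that $r\mapsto h(r)/r$ is positive and nonincreasing on $(0,\varepsilon]$, for some $\varepsilon>0$ (only behaviour near zero matters; functions such as $h_{\alpha/t,3f_\eta}$ are extended by $0$ at $0$). For $g,h\in\mathfrak{D}_1$, $g\prec h$ means that $g/h$ monotonically tends to infinity at zero. For $h\in\mathfrak{D}_1$ let $\varepsilon_h$ be the supremum of all $\varepsilon\in(0,1]$ such that $h$ is continuous and nondecreasing on $[0,\varepsilon]$ and $h(r)/r$ is positive and nonincreasing on $(0,\varepsilon]$. Let $\Lambda_c$ be the collection of $c$-adic intervals $c^{-j}(k+[0,1))$, $j,k\in\mathbb{Z}$. For $F\subseteq\mathbb{R}$, $\mathcal{M}^h_\infty(F)=\inf\sum_{p\ge1}h(|\lambda_p|)$, the infimum being over all sequences $(\lambda_p)_{p\in\mathbb{N}}$ in $\Lambda_c\cup\{\emptyset\}$ with $F\subseteq\bigcup_p\lambda_p$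 and $|\lambda_p|<\varepsilon_h$ for all $p$ ($|\cdot|$ denotes diameter). For $h\in\mathfrak{D}_1$, $\mathrm{G}^h(\mathbb{R})$ is the collection of all $G_\delta$-subsets $F$ of $\mathbb{R}$ such that $\mathcal{M}^g_\infty(F\cap U)=\mathcal{M}^g_\infty(U)$ for every $g\in\mathfrak{D}_1$ with $g\prec h$ and every open $U\subseteq\mathbb{R}$. (It is known that this class does not depend on the integer base used for the intervals.) *)

(* Defs.v *)
From HB Require Import structures.
From mathcomp Require Import all_boot all_order all_algebra.
From mathcomp Require Import all_classical all_reals all_analysis.
From mathcomp Require Import borel_hierarchy.

Set Implicit Arguments.
Unset Strict Implicit.
Unset Printing Implicit Defensive.

Import Order.TTheory GRing.Theory Num.Theory.
Import numFieldNormedType.Exports.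

Local Open Scope classical_set_scope.
Local Open Scope ring_scope.

Definition log_base {R : realType} (c : nat) (x : R) : R := ln x / ln c%:R.

(* The digits are d 1, d 2, ...; the value d 0 plays no role and the integer
   part is the separate x0. *)
Definition is_digit_seq {R : realType} (c : nat) (x : R) (d : nat -> nat) : Prop :=
  [/\ forall p, (d p < c)%N,
      ~ (\forall p \near \oo, d p = c.-1)
    & exists x0 : int,
        [series (d p.+1)%:R / c%:R ^+ p.+1]_p @ \oo --> x - x0%:~R].

Definition digit {R : realType} (c : nat) (x : R) : nat -> nat :=
  get (is_digit_seq c x).

(* The ordinal p : 'I_j stands for the index p + 1 in {1, ..., j}. *)
Definition digit_freq {R : realType} (c b j : nat) (x : R) : R :=
  #|[set p : 'I_j | digit c x p.+1 == b]%SET|%:R / j%:R.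

Definition approx_freq_set {R : realType} (c : nat) (prob : 'I_c -> R) (t : R) :
    set R :=
  [set x | exists p : nat -> int, exists q : nat -> nat,
    [/\ forall n, (0 < q n)%N && coprimez (p n) (q n)%:Z,
        q @ \oo --> \oo,
        forall n,
          `|x - (p n)%:~R / (q n)%:R| <= (q n)%:R `^ (- (2 * t))
      & forall b : 'I_c,
          digit_freq c b (Num.truncn (2 * log_base c ((q n)%:R : R)))
            ((p n)%:~R / (q n)%:R : R) @[n --> \oo] --> prob b]].

Definition entropy {R : realType} (c : nat) (prob : 'I_c -> R) : R :=
  - \sum_(b < c) prob b * log_base c (prob b).

Definition gauge_upto {R : realType} (h : R -> R) (e : R) : Prop :=
  [/\ {within `[0, e], continuous h},
      {in `[0, e] &, nondecreasing_fun h},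
      {in `]0, e], forall r, 0 < h r / r}
    & {in `]0, e] &, nonincreasing_fun (fun r => h r / r)}].

(* Gauges are total functions on R; their values at negative reals are
   never used. *)
Definition gauge {R : realType} (h : R -> R) : Prop :=
  h 0 = 0 /\ exists2 e : R, 0 < e & gauge_upto h e.

Definition gauge_prec {R : realType} (g h : R -> R) : Prop :=
  (exists2 e : R, 0 < e &
     {in `]0, e] &, nonincreasing_fun (fun r => g r / h r)}) /\
  g r / h r @[r --> 0^'+] --> +oo.

Definition gauge_radius {R : realType} (h : R -> R) : R :=
  sup [set e | 0 < e <= 1 /\ gauge_upto h e].

Definition adic_interval {R : realType} (c : nat) : set (set R) :=
  [set l | exists j k : int,
     l = [set c%:R ^ (- j) * (k%:~R + u) | u in `[0, 1[]].

(* Only applied to bounded sets; the empty set gets diameter 0. *)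
Definition diameter {R : realType} (A : set R) : R :=
  sup [set `|x.1 - x.2| | x in A `*` A].

Definition net_content {R : realType} (c : nat) (h : R -> R) (F : set R) : \bar R :=
  ereal_inf
    [set (\sum_(0 <= p <oo) (h (diameter (l p)))%:E)%E | l in
      [set l : nat -> set R |
        [/\ forall p, (adic_interval c `|` [set set0]) (l p),
            F `<=` \bigcup_p l p
          & forall p, diameter (l p) < gauge_radius h]]].

Definition large_intersection {R : realType} (c : nat) (h : R -> R) : set (set R) :=
  [set F | Gdelta F /\
    forall g : R -> R, gauge g -> gauge_prec g h ->
    forall U : set R, open U ->
      net_content c g (F `&` U) = net_content c g U].

Definition f_eta {R : realType} (eta r : R) : R := (- ln r) `^ (eta - 1 / 8).

Definition hgauge {R : realType} (s : R) (phi : R -> R) (r : R) : R :=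
  if r == 0 then 0 else r `^ (s - phi r).

(* Main.v *)
(* The set is [F = \bigcap_i V_i], where [V_i] is the union of the open balls
   [B(p/q, q^(-2t))] over the irreducible [p/q] with [q >= i] whose digit
   frequencies are within [1/(i+1)] of [prob].  To see that a cover of [F] inside
   a c-adic interval [I] costs at least [g(|I|)], one builds a point of [F] that a
   cheaper cover misses, by descending through c-adic intervals that are not
   covered and in which the cover costs less than the gauge of the interval.  One
   descends first a few generations by averaging uniformly over the children,
   which gains a factor, and then by averaging over the words of length [M]
   weighted by the product measure of [prob].  Outside a small part of the words
   (i) all prefixes have weight about [c^(-alpha l)] and the frequencies are right
   (Chernoff), and (ii) the center of the word interval is not close to a fraction
   with a small denominator: distinct fractions with denominators about [c^a] are
   [c^(-2a)] apart, while the product measure of an interval decays geometrically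
   under subdivision.  By (ii), Dirichlet's theorem gives in the word interval a
   fraction whose denominator is about the inverse square root of its length, so
   the ball around it belongs to [V_i]; by (i), the weights are bounded by [g], so
   that some of these balls still contains a cheap, uncovered interval. *)

Require Import Defs.
From HB Require Import structures.
From mathcomp Require Import all_boot all_order all_algebra.
From mathcomp Require Import all_classical all_reals all_analysis.
From mathcomp Require Import ring lra zify.

Set Implicit Arguments.
Unset Strict Implicit.
Unset Printing Implicit Defensive.

Import Order.TTheory GRing.Theory Num.Theory.
Import numFieldNormedType.Exports.

Local Open Scope classical_set_scope.
Local Open Scope ring_scope.

(** * Covers by nodes of the c-adic tree *)

(** A pair [(N, K)] stands for the interval [[K c^-N, (K+1) c^-N)]; its ancestor [d] generations up
    comes from dividing [K] by [c^d] with rounding down. Natural generations suffice, since the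
    lengths in a cover stay below a gauge radius, which is at most 1. *)
Definition sub_node (c : nat) (a b : nat * int) : bool :=
  (b.1 <= a.1)%N && ((a.2 %/ (c ^ (a.1 - b.1))%:Z)%Z == b.2).

Definition osub_node (c : nat) (a : option (nat * int)) (b : nat * int) : bool :=
  if a is Some a' then sub_node c a' b else false.

Definition covers_node (c : nat) (a : option (nat * int)) (b : nat * int) : bool :=
  if a is Some a' then sub_node c b a' else false.

Definition node_wt {R : realType} (G : nat -> R) (a : option (nat * int)) : R :=
  if a is Some a' then G a'.1 else 0.

(** The part of the cost of a cover that is paid inside [b]; members reaching beyond [b] are ruled
    out separately through [covers_node]. In a cover, [None] encodes the empty set. *)
Definition node_cost {R : realType} (c : nat) (G : nat -> R)
    (o : nat -> option (nat * int)) (b : nat * int) : \bar R :=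
  (\sum_(0 <= p <oo) (if osub_node c (o p) b then node_wt G (o p) else 0)%:E)%E.

Lemma sub_node_refl (c : nat) (a : nat * int) : sub_node c a a.
Proof. by rewrite /sub_node leqnn subnn expn0 divz1 eqxx. Qed.

Lemma divz_exp_add (c : nat) (K : int) (a b : nat) :
  (K %/ (c ^ (a + b))%:Z)%Z = ((K %/ (c ^ a)%:Z)%Z %/ (c ^ b)%:Z)%Z.
Proof. by rewrite expnD PoszM divzMA_ge0. Qed.

Lemma sub_node_trans (c : nat) (b a d : nat * int) :
  sub_node c a b -> sub_node c b d -> sub_node c a d.
Proof.
move=> /andP[ba /eqP ab] /andP[db /eqP bd].
rewrite /sub_node (leq_trans db ba) /=.
have -> : (a.1 - d.1 = (a.1 - b.1) + (b.1 - d.1))%N.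
  by rewrite addnBA // subnK.
by rewrite divz_exp_add ab bd.
Qed.

Lemma sub_node_common (c : nat) (a b d : nat * int) :
  sub_node c a b -> sub_node c a d -> (d.1 <= b.1)%N -> sub_node c b d.
Proof.
move=> /andP[ba /eqP ab] /andP[da /eqP ad] db.
rewrite /sub_node db /= -ab -divz_exp_add.
by rewrite addnBA // subnK // ad.
Qed.

Lemma sub_node_comparable (c : nat) (a b d : nat * int) :
  sub_node c a b -> sub_node c a d -> sub_node c b d || sub_node c d b.
Proof.
move=> ab ad; have [db|/ltnW bd] := leqP d.1 b.1.
  by rewrite (sub_node_common ab ad db).
by rewrite (sub_node_common ad ab bd) orbT.
Qed.

Lemma sub_node_eq (c : nat) (a b : nat * int) :
  sub_node c a b -> a.1 = b.1 -> a = b.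
Proof.
case: a b => [n K] [m L] /andP[/= _ /eqP <-] ->.
by rewrite subnn expn0 divz1.
Qed.

(* If every node [d y] were covered or expensive, the cover would carry at
   least the whole mass of the distribution [w] on the nodes [d y], hence
   would cost at least [tau]. *)
Lemma exists_cheap_node (R : realType) (c : nat) (G : nat -> R)
    (o : nat -> option (nat * int)) (b : nat * int) (I : finType) (A : pred I)
    (w : I -> R) (m : nat) (d : I -> int) (tau tau' : R) :
  (forall N, 0 <= G N) -> 0 < tau -> 0 < tau' ->
  (forall y, A y -> 0 <= w y) ->
  1 <= \sum_(y | A y) w y ->
  (forall y, A y -> sub_node c (m, d y) b) ->
  {in A &, injective d} ->
  (forall z, sub_node c z b -> (z.1 <= m)%N ->
     (\sum_(y | A y && sub_node c (m, d y) z) w y) * tau <= G z.1) ->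
  (forall y, A y -> w y * tau <= tau') ->
  (forall p, ~~ covers_node c (o p) b) ->
  (node_cost c G o b < tau%:E)%E ->
  exists2 y, A y & (forall p, ~~ covers_node c (o p) (m, d y)) /\
    (node_cost c G o (m, d y) < tau'%:E)%E.
Proof.
move=> G0 tau0 tau'0 w0 w1 dsub dinj dG dtau nocov cost.
apply: contrapT => noy.
(* [u p y] is the share of member [p] in blocking [y]. If no [y] is cheap and uncovered, the shares
   at each [y] add up to at least 1 ([u1]); averaged with [w] and summed over [p] by [key], they
   give at most the cost divided by [tau], which is below 1. *)
pose u p y : R := if covers_node c (o p) (m, d y) then 1 else
  if osub_node c (o p) (m, d y) then node_wt G (o p) / tau' else 0.
have wt0 p : 0 <= node_wt G (o p) by case: (o p) => //= a.
have u0 p y : 0 <= u p y.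
  by rewrite /u; case: ifP => // _; case: ifP => // _; rewrite divr_ge0 // ltW.
have u1 y : A y -> (1 <= \sum_(0 <= p <oo) (u p y)%:E)%E.
  move=> Ay; have [[p cov]|nocovy] := pselect (exists p, covers_node c (o p) (m, d y)).
    rewrite (@nneseriesD1 _ _ p) //; last by move=> k _; rewrite lee_fin.
    rewrite {1}/u cov leeDl //.
    by apply: nneseries_ge0 => k _ _; rewrite lee_fin.
  have nc p : covers_node c (o p) (m, d y) = false.
    by apply/negbTE/negP => cov; apply: nocovy; exists p.
  have : ~~ (node_cost c G o (m, d y) < tau'%:E)%E.
    by apply/negP => lt; apply: noy; exists y => //; split=> // p; rewrite nc.
  rewrite -leNgt => le1.
  have -> : (\sum_(0 <= p <oo) (u p y)%:E)%E =
            (tau'^-1%:E * node_cost c G o (m, d y))%E.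
    rewrite /node_cost -nneseriesZl; last first.
      by move=> p _; rewrite lee_fin; case: ifP.
    apply: eq_eseriesr => p _; rewrite -EFinM /u nc.
    by case: ifP => _; [rewrite mulrC|rewrite mulr0].
  have : (tau'^-1%:E * tau'%:E <= tau'^-1%:E * node_cost c G o (m, d y))%E.
    by apply: lee_wpmul2l => //; rewrite lee_fin invr_ge0 ltW.
  by rewrite -EFinM mulVf ?gt_eqF.
(* An empty member, or one not inside [b], contributes nothing. A member of generation at most [m]
   blocks the nodes [d y] inside it, whose weight [dG] bounds; a finer one lies in at most one
   [d y], where [dtau] applies. *)
have key p : \sum_(y | A y) w y * u p y <=
    tau^-1 * (if osub_node c (o p) b then node_wt G (o p) else 0).
  have tV0 : 0 <= tau^-1 by rewrite invr_ge0 ltW.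
  case op : (o p) => [z|]; last first.
    rewrite /= mulr0 big1 // => y Ay.
    by rewrite /u op /= mulr0.
  rewrite /=.
  have [zb|nzb] := boolP (sub_node c z b); last first.
    rewrite mulr0 big1 // => y Ay; rewrite /u op /=; case: ifP => [yz|_].
      have := sub_node_comparable yz (dsub _ Ay).
      by rewrite (negbTE nzb) /= => bz; have := nocov p; rewrite op /= bz.
    case: ifP => [zy|_]; last by rewrite mulr0.
    by rewrite (sub_node_trans zy (dsub _ Ay)) in nzb.
  have [zm|mz] := leqP z.1 m.
    rewrite -ler_pdivrMl ?invr_gt0 // invrK mulrC.
    apply: le_trans (dG z zb zm).
    apply: ler_wpM2r; first exact: ltW.
    rewrite big_mkcondr /= ler_sum // => y Ay.
    rewrite /u op /=; case: ifP => [_|nyz]; first by rewrite mulr1.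
    case: ifP => [zy|_]; last by rewrite mulr0.
    have zm' : z.1 = m by apply/eqP; rewrite eqn_leq zm /=; case/andP: zy.
    have e := sub_node_eq zy zm'; by rewrite e sub_node_refl in nyz.
  have ncov y : sub_node c (m, d y) z = false.
    by rewrite /sub_node /= leqNgt mz.
  have [[y0 Ay0 zy0]|noy0] := pselect (exists2 y, A y & sub_node c z (m, d y)).
    rewrite (bigD1 y0) //= big1 => [|y /andP[Ay yy0]]; last first.
      rewrite /u op /= ncov; case: ifP => [zy|]; last by rewrite mulr0.
      have /sub_node_eq/(_ erefl)[/dinj e] := sub_node_common zy0 zy (leqnn _).
      by move: yy0; rewrite e ?eqxx.
    rewrite addr0 /u op /= ncov zy0 mulrA mulrAC ler_wpM2r //.
    by rewrite ler_pdivrMr // mulrC ler_pdivlMr // dtau.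
  rewrite big1 ?mulr_ge0 // => y Ay.
  rewrite /u op /= ncov; case: ifP => [zy|]; last by rewrite mulr0.
  by exfalso; apply: noy0; exists y.
have : (1 < 1%:E :> \bar R)%E; last by rewrite ltxx.
apply: (@le_lt_trans _ _ (\sum_(y | A y) (w y)%:E)%E); first by rewrite sumEFin lee_fin.
apply: (@le_lt_trans _ _ (\sum_(y | A y) \sum_(0 <= p <oo) (w y * u p y)%:E)%E).
  apply: lee_sum => y Ay.
  under eq_eseriesr do rewrite EFinM.
  rewrite nneseriesZl; last by move=> p _; rewrite lee_fin.
  by rewrite -{1}[(w y)%:E]mule1; apply: lee_wpmul2l; [rewrite lee_fin w0|exact: u1].
rewrite -nneseries_sum; last by move=> y p Ay; rewrite lee_fin mulr_ge0 // w0.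
apply: (@le_lt_trans _ _ (tau^-1%:E * node_cost c G o b)%E).
  rewrite /node_cost -nneseriesZl; last by move=> p _; rewrite lee_fin; case: ifP.
  apply: lee_nneseries => [p _|p _].
    by rewrite sumEFin lee_fin sumr_ge0 // => y Ay; rewrite mulr_ge0 // w0.
  by rewrite sumEFin -EFinM lee_fin.
have -> : 1%:E = (tau^-1%:E * tau%:E)%E :> \bar R by rewrite -EFinM mulVf ?gt_eqF.
by rewrite lte_pmul2l // lte_fin invr_gt0.
Qed.

(** * Product weights on words *)

(** A word of length [d] is a natural number below [c^d] read in base [c]. Index 0 is its last
    letter, and the prefix of length [l] of a word of length [M] is the quotient by [c^(M-l)]. *)
Definition wprod {R : realType} (phi : nat -> R) (c d y : nat) : R :=
  \prod_(i < d) phi (y %/ c ^ i %% c)%N.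

Definition dsum {R : realType} (f : nat -> R) (c d y : nat) : R :=
  \sum_(i < d) f (y %/ c ^ i %% c)%N.

Section Digits.
Variables (R : realType) (c : nat).
Hypothesis hc : (1 < c)%N.
Implicit Types (phi f : nat -> R).

Lemma wprod_add phi (l d y : nat) :
  wprod phi c (l + d) y = wprod phi c l (y %/ c ^ d) * wprod phi c d y.
Proof.
rewrite addnC /wprod big_split_ord /= mulrC; congr (_ * _).
by apply: eq_bigr => i _; rewrite expnD divnMA.
Qed.

Lemma digit_low (i d z u : nat) : (i < d)%N ->
  ((z * c ^ d + u) %/ c ^ i %% c = u %/ c ^ i %% c)%N.
Proof.
move=> id; have c0 : (0 < c)%N by apply: ltn_trans hc.
have -> : (z * c ^ d = (z * c ^ (d - i.+1) * c) * c ^ i)%N.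
  by rewrite -!mulnA -expnS -expnD subnK.
by rewrite divnMDl ?expn_gt0 ?c0 // modnMDl.
Qed.

Lemma wprod_low phi (d z u : nat) :
  wprod phi c d (z * c ^ d + u) = wprod phi c d u.
Proof. by apply: eq_bigr => i _; rewrite digit_low. Qed.

Lemma sum_block (a b : nat) (F : nat -> R) :
  \sum_(0 <= y < a * b) F y = \sum_(0 <= z < a) \sum_(0 <= u < b) F (z * b + u)%N.
Proof.
rewrite big_nat_mul; apply: eq_bigr => z _.
rewrite -{1}[(z * b)%N]add0n big_addn mulSn addnK.
by apply: eq_bigr => u _; rewrite addnC.
Qed.

Lemma sum_block_wprod phi (l d : nat) (F : nat -> R) :
  \sum_(0 <= y < c ^ (l + d)) F (y %/ c ^ d)%N * wprod phi c d y =
  (\sum_(0 <= z < c ^ l) F z) * (\sum_(0 <= u < c ^ d) wprod phi c d u).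
Proof.
rewrite expnD sum_block big_distrl /=; apply: eq_bigr => z _.
rewrite big_distrr /= big_nat [RHS]big_nat; apply: eq_bigr => u /= ud.
rewrite wprod_low divnMDl ?expn_gt0 ?(ltn_trans _ hc) //.
by rewrite (divn_small ud) addn0.
Qed.

Lemma sum_wprod phi (d : nat) :
  \sum_(0 <= y < c ^ d) wprod phi c d y = (\sum_(0 <= b < c) phi b) ^+ d.
Proof.
elim: d => [|d IH]; first by rewrite expn0 big_nat1 /wprod big_ord0 expr0.
have := sum_block_wprod phi d 1 (wprod phi c d).
rewrite addn1 expn1 => e.
rewrite exprSr -IH -[X in _ * X](_ : \sum_(0 <= u < c) wprod phi c 1 u = _).
  by rewrite -e; apply: eq_bigr => y _; rewrite -[in LHS]addn1 wprod_add expn1.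
rewrite big_nat [RHS]big_nat; apply: eq_bigr => b /= bc.
by rewrite /wprod big_ord1 expn0 divn1 modn_small.
Qed.

Lemma wprod_ge0 phi (d y : nat) :
  (forall b, 0 <= phi b) -> 0 <= wprod phi c d y.
Proof. by move=> phi0; apply: prodr_ge0. Qed.

Lemma wprod_le phi (rho : R) (d y : nat) :
  (forall b, 0 <= phi b <= rho) -> wprod phi c d y <= rho ^+ d.
Proof.
move=> h; rewrite -[X in _ <= _ ^+ X]card_ord -prodr_const.
by apply: ler_prod => i _.
Qed.

(** From [expR (- x) >= 1 - x] follows [expR x <= 1 / (1 - x)], and [(1 - x)(1 + x + 2 x^2) = 1 +
    x^2 (1 - 2 x)] is at least 1. *)
Lemma expR_le_quadratic (x : R) : x <= 1 / 2 -> expR x <= 1 + x + 2 * x ^+ 2.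
Proof.
move=> x2; have x1 : 0 < 1 - x by lra.
have h : 1 - x <= expR (- x) by rewrite expR_ge1Dx.
have : expR x <= (1 - x)^-1.
  by rewrite -[expR x]invrK lef_pV2 ?posrE ?invr_gt0 ?expR_gt0 // -expRN.
move/le_trans; apply; rewrite -[X in X <= _]mul1r ler_pdivrMr //.
have : 0 <= x ^+ 2 * (1 - 2 * x) by apply: mulr_ge0; [exact: sqr_ge0|lra].
by rewrite !expr2; lra.
Qed.

Lemma expR_dsum phi f (d y : nat) :
  wprod phi c d y * expR (dsum f c d y) =
  wprod (fun b => phi b * expR (f b)) c d y.
Proof. by rewrite /wprod big_split /= /dsum expR_sum. Qed.

(** * Product probability measures on words: concentration and the Chernoff bound *)

Section Probability.
Variables (P : nat -> R).
Hypothesis P0 : forall b, 0 <= P b.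
Hypothesis P1 : \sum_(0 <= b < c) P b = 1.

Lemma sum_wprod1 (d : nat) : \sum_(0 <= y < c ^ d) wprod P c d y = 1.
Proof. by rewrite sum_wprod P1 expr1n. Qed.

Lemma sum_wprod_marginal (l d : nat) (A : pred nat) :
  \sum_(0 <= y < c ^ (l + d) | A (y %/ c ^ d)%N) wprod P c (l + d) y =
  \sum_(0 <= z < c ^ l | A z) wprod P c l z.
Proof.
rewrite big_mkcond [RHS]big_mkcond.
rewrite -[RHS]mulr1 -(sum_wprod1 d) -sum_block_wprod.
by apply: eq_bigr => y _; case: ifP => _; rewrite ?mul0r // wprod_add.
Qed.

Lemma sum_wprod_fiber (l d z : nat) : (z < c ^ l)%N ->
  \sum_(0 <= y < c ^ (l + d) | (y %/ c ^ d)%N == z) wprod P c (l + d) y =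
  wprod P c l z.
Proof.
move=> zl; rewrite (sum_wprod_marginal _ _ (pred1 z)).
rewrite big_mkord (big_pred1 (Ordinal zl)) //.
Qed.

(** The hypothesis holds in both orders, so two elements of [B] differ by at most 1 and [B] is
    contained in [{m, m+1}] for its least element [m]. *)
Lemma count_consecutive (n : nat) (B : pred nat) :
  (forall u v, (u < n)%N -> (v < n)%N -> B u -> B v -> (u <= v.+1)%N) ->
  \sum_(0 <= u < n | B u) (1 : R) <= 2.
Proof.
move=> hB.
have [[u0 /andP[u0n Bu0]]|noB] := pselect (exists u, (u < n)%N && B u); last first.
  rewrite big_nat_cond big1 // => u; rewrite leq0n /= => un.
  by exfalso; apply: noB; exists u.
have ex : exists u, (u < n)%N && B u by exists u0; rewrite u0n.
case: (ex_minnP ex) => m /andP[mn Bm] mmin.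
have dirac (k : nat) : \sum_(0 <= u < n) ((u == k)%:R : R) <= 1.
  rewrite big_mkord; have [kn|nk] := ltnP k n.
    rewrite (bigD1 (Ordinal kn)) //= eqxx big1 ?addr0 // => i ik.
    by have /negbTE -> : (i : nat) != k by apply: contra ik => /eqP e; apply/eqP/val_inj.
  by rewrite big1 // => i _; rewrite (ltn_eqF (leq_trans (ltn_ord i) nk)).
have -> : (2 : R) = 1 + 1 by lra.
apply: le_trans (lerD (dirac m) (dirac m.+1)).
rewrite -big_split /= big_mkcond /= big_nat [leRHS]big_nat.
apply: ler_sum => u /= un; case: ifP => [Bu|_].
  have mu := mmin _ (introT andP (conj un Bu)).
  have um := hB _ _ un mn Bu Bm.
  have [->|ne] := eqVneq u m; first by rewrite lerDl ler0n.
  have -> : u = m.+1 by apply/eqP; rewrite eqn_leq um ltn_neqAle eq_sym ne.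
  by rewrite eqxx lerDr ler0n.
by rewrite addr_ge0 // ler0n.
Qed.

(** Once the first [e] letters are fixed, the next [f] letters take at most two consecutive values
    on [A], each of conditional weight at most [rho^f]; the last [g] letters are summed out. *)
Lemma sum_wprod_concentrated (rho : R) (e f g : nat) (A : pred nat) :
  (forall b, P b <= rho) ->
  (forall y y', (y < c ^ (e + f + g))%N -> (y' < c ^ (e + f + g))%N ->
     A y -> A y' -> (y %/ c ^ (f + g) = y' %/ c ^ (f + g))%N ->
     (y %/ c ^ g <= (y' %/ c ^ g).+1)%N) ->
  \sum_(0 <= y < c ^ (e + f + g) | A y) wprod P c (e + f + g) y <= 2 * rho ^+ f.
Proof.
move=> Prho hA; have c0 : (0 < c)%N by apply: ltn_trans hc.
have cX n : (0 < c ^ n)%N by rewrite expn_gt0 c0.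
pose M := (e + f + g)%N.
(* Passing to all words whose prefix of length [e + f] extends to a word of [A] makes the event
   independent of the last [g] letters. *)
pose A' z := [exists y : 'I_(c ^ M), A y && ((y %/ c ^ g)%N == z)].
apply: (@le_trans _ _ (\sum_(0 <= y < c ^ M | A' (y %/ c ^ g)%N) wprod P c M y)).
  rewrite big_mkcond [leRHS]big_mkcond /= big_nat [leRHS]big_nat.
  apply: ler_sum => y /= yM.
  case: ifP => Ay; last by case: ifP => // _; exact: wprod_ge0.
  by rewrite ifT //; apply/existsP; exists (Ordinal yM); rewrite Ay /=.
rewrite sum_wprod_marginal big_mkcond /= expnD sum_block.
apply: (@le_trans _ _ (\sum_(0 <= z < c ^ e) (2 * rho ^+ f) * wprod P c e z)); last first.
  by rewrite -mulr_sumr sum_wprod1 mulr1.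
rewrite big_nat [leRHS]big_nat; apply: ler_sum => z /= ze.
pose B u := A' (z * c ^ f + u)%N.
have rho0 : 0 <= rho by apply: le_trans (Prho 0%N).
have hB : forall u v, (u < c ^ f)%N -> (v < c ^ f)%N -> B u -> B v -> (u <= v.+1)%N.
  move=> u v uf vf /existsP[y /andP[Ay /eqP ey]] /existsP[y' /andP[Ay' /eqP ey']].
  have := hA _ _ (ltn_ord y) (ltn_ord y') Ay Ay'.
  rewrite [(f + g)%N]addnC expnD !divnMA ey ey' !divnMDl // !divn_small //.
  by move=> /(_ erefl); rewrite -addnS leq_add2l.
apply: (@le_trans _ _ (\sum_(0 <= u < c ^ f | B u) (wprod P c e z * rho ^+ f) * 1)).
  rewrite [leRHS]big_mkcond /= big_nat [leRHS]big_nat.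
  apply: ler_sum => u /= uf; rewrite -/(B u); case: ifP => // _.
  rewrite mulr1 wprod_add divnMDl // divn_small // addn0 ler_wpM2l ?wprod_ge0 //.
  by apply: wprod_le => b; rewrite P0 Prho.
rewrite -mulr_sumr [leRHS](_ : _ = wprod P c e z * rho ^+ f * 2); last by ring.
apply: ler_wpM2l; first by rewrite mulr_ge0 ?wprod_ge0 ?exprn_ge0.
exact: count_consecutive.
Qed.

(** Markov's inequality for [expR (theta * dsum f)]. Its mean is the [l]-th power of a one-letter
    mean, whose linear term vanishes because [f] is centred, so that [1 + 2 (theta B)^2] bounds
    it. *)
Lemma chernoff f (B theta Delta : R) (l : nat) :
  (forall b, (b < c)%N -> `|f b| <= B) ->
  \sum_(0 <= b < c) P b * f b = 0 ->
  0 <= theta -> theta * B <= 1 / 2 ->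
  \sum_(0 <= y < c ^ l | Delta <= dsum f c l y) wprod P c l y <=
    expR (2 * (theta * B) ^+ 2 * l%:R - theta * Delta).
Proof.
move=> fB f0 th0 thB.
apply: (@le_trans _ _ (\sum_(0 <= y < c ^ l) expR (- (theta * Delta)) *
    (wprod (fun b => P b * expR (theta * f b)) c l y))).
  rewrite big_mkcond /=; apply: ler_sum => y _.
  have -> : wprod (fun b => P b * expR (theta * f b)) c l y =
      wprod P c l y * expR (theta * dsum f c l y).
    by rewrite -expR_dsum /dsum mulr_sumr.
  rewrite mulrCA -expRD.
  case: ifP => [Df|_]; last by rewrite mulr_ge0 ?wprod_ge0 ?expR_ge0.
  rewrite -[leLHS]mulr1 ler_wpM2l ?wprod_ge0 // -expR0 ler_expR.
  by rewrite addrC subr_ge0 ler_wpM2l.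
rewrite -mulr_sumr sum_wprod addrC expRD ler_wpM2l ?expR_ge0 //.
rewrite expRM_natr; apply: lerXn2r.
- by rewrite nnegrE sumr_ge0 // => b _; rewrite mulr_ge0 ?expR_ge0.
- by rewrite nnegrE expR_ge0.
apply: (@le_trans _ _ (1 + 2 * (theta * B) ^+ 2)); last exact: expR_ge1Dx.
apply: (@le_trans _ _ (\sum_(0 <= b < c)
    (P b * (1 + 2 * (theta * B) ^+ 2) + theta * (P b * f b)))); last first.
  by rewrite big_split /= -mulr_suml P1 mul1r -mulr_sumr f0 mulr0 addr0.
rewrite big_nat [leRHS]big_nat; apply: ler_sum => b /= bc.
have fb := fB b bc; have B0 : 0 <= B by apply: le_trans fb.
have tf : `|theta * f b| <= theta * B by rewrite normrM ger0_norm // ler_wpM2l.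
rewrite [leRHS](_ : _ = P b * (1 + 2 * (theta * B) ^+ 2 + theta * f b)); last by ring.
rewrite ler_wpM2l //.
apply: le_trans (expR_le_quadratic _) _.
  by apply: le_trans (ler_norm _) (le_trans tf thB).
have : (theta * f b) ^+ 2 <= (theta * B) ^+ 2.
  by rewrite -[(theta * f b) ^+ 2]real_normK ?num_real // lerXn2r // nnegrE mulr_ge0.
by lra.
Qed.
End Probability.
End Digits.

(** * Adic digits and Dirichlet approximation *)

(** Explicit digits from floors; [digitE] identifies them with the ones chosen by [get]. *)
Definition adic_digit {R : realType} (c : nat) (x : R) (p : nat) : nat :=
  `|(Num.floor (x * c%:R ^+ p) %% c%:Z)%Z|%N.

Section Adic.
Variables (R : realType) (c : nat).
Hypothesis hc : (1 < c)%N.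
Implicit Types x : R.

Lemma base_gt0 : 0 < c%:R :> R.
Proof. by rewrite ltr0n (ltn_trans _ hc). Qed.

Lemma baseX_gt0 (n : nat) : 0 < c%:R ^+ n :> R.
Proof. by rewrite exprn_gt0 // base_gt0. Qed.

Lemma base_gt1 : 1 < c%:R :> R.
Proof. by rewrite ltr1n. Qed.

(** Rounding at scale [c^-N] factors through any finer scale, which ties the nodes containing a real
    number to integer division in the tree. *)
Lemma floor_divz x (N d : nat) :
  (Num.floor (x * c%:R ^+ (N + d)) %/ (c ^ d)%:Z)%Z = Num.floor (x * c%:R ^+ N).
Proof.
apply/esym/floor_def.
set K := Num.floor _.
have D0 : 0 < (c ^ d)%:Z by rewrite ltz_nat expn_gt0 (ltn_trans _ hc).
have e := divz_eq K (c ^ d)%:Z.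
have h1 := modz_ge0 K (lt0r_neq0 D0).
have h2 := ltz_pmod K D0.
have /andP[k1 k2] : K%:~R <= x * c%:R ^+ (N + d) < (K + 1)%:~R by exact: floor_itv.
set q := (K %/ _)%Z in e *.
have l1 : q * (c ^ d)%:Z <= K by rewrite e lerDl.
have l2 : K + 1 <= (q + 1) * (c ^ d)%:Z.
  by rewrite mulrDl mul1r [X in X + 1 <= _]e -addrA lerD2l lezD1.
have dE : ((c ^ d)%:Z)%:~R = c%:R ^+ d :> R by rewrite -natrX.
move: l1 l2; rewrite -!(ler_int R) ![(_ * (c ^ d)%:Z)%:~R]intrM dE => l1 l2.
rewrite exprD mulrA in k1 k2.
rewrite -(ler_pM2r (baseX_gt0 d)) -[X in _ && X](ltr_pM2r (baseX_gt0 d)).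
by rewrite (le_trans l1 k1) (lt_le_trans k2 l2).
Qed.

Lemma floor_digit x (p : nat) :
  Num.floor (x * c%:R ^+ p.+1) =
  Num.floor (x * c%:R ^+ p) * c%:Z + (adic_digit c x p.+1)%:Z.
Proof.
have c0 : c%:Z != 0 by rewrite eqz_nat gtn_eqF // (ltn_trans _ hc).
rewrite {1}(divz_eq (Num.floor (x * c%:R ^+ p.+1)) c%:Z) -[p.+1]addn1.
rewrite -(floor_divz _ p 1) expn1; congr (_ + _).
by rewrite /adic_digit gez0_abs // modz_ge0.
Qed.

Lemma adic_digit_lt x (p : nat) : (adic_digit c x p < c)%N.
Proof.
have c0 : 0 < c%:Z by rewrite ltz_nat (ltn_trans _ hc).
by rewrite -ltz_nat /adic_digit gez0_abs ?ltz_pmod // modz_ge0 // lt0r_neq0.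
Qed.

Lemma cvg_baseVX : (c%:R ^+ n)^-1 @[n --> \oo] --> (0 : R).
Proof.
have : `|c%:R^-1 : R| < 1.
  by rewrite gtr0_norm ?invr_gt0 ?base_gt0 // invf_lt1 ?base_gt0 // base_gt1.
move/cvg_expr; apply: cvg_trans; apply: near_eq_cvg.
by near=> n; rewrite exprVn.
Unshelve. all: by end_near. Qed.

Lemma cvg_floor_adic x :
  (Num.floor (x * c%:R ^+ n))%:~R / c%:R ^+ n @[n --> \oo] --> x.
Proof.
have low : (x - (c%:R ^+ n)^-1) @[n --> \oo] --> x.
  by rewrite -{2}[x]subr0; apply: cvgB; [exact: cvg_cst|exact: cvg_baseVX].
apply: (@squeeze_cvgr _ _ _ _ (fun n => x - (c%:R ^+ n)^-1) (fun=> x)) => //; last exact: cvg_cst.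
near=> n.
have /andP[h1 h2] := floor_itv (x * c%:R ^+ n).
rewrite ler_pdivrMr ?baseX_gt0 // h1 andbT.
rewrite ler_pdivlMr ?baseX_gt0 // mulrBl mulVf ?gt_eqF ?baseX_gt0 //.
by move: h2; rewrite intrD; lra.
Unshelve. all: by end_near. Qed.

Lemma adic_digit_series x (n : nat) :
  [series (adic_digit c x p.+1)%:R / c%:R ^+ p.+1]_p n =
  (Num.floor (x * c%:R ^+ n))%:~R / c%:R ^+ n - (Num.floor x)%:~R :> R.
Proof.
elim: n => [|n IH].
  by rewrite /series /= big_nil expr0 mulr1 divr1 subrr.
rewrite /series /= in IH *; rewrite big_nat_recr //= IH floor_digit.
rewrite intrD intrM mulrDl !exprSr.
have cn0 := lt0r_neq0 (baseX_gt0 n); have c0 := lt0r_neq0 base_gt0.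
rewrite -[(c%:Z)%:~R]/(c%:R) -[((adic_digit c x n.+1)%:Z)%:~R]/((adic_digit c x n.+1)%:R).
by field; rewrite cn0 c0.
Qed.

Lemma is_digit_seq_adic x : is_digit_seq c x (adic_digit c x).
Proof.
split; first exact: adic_digit_lt.
- move=> [p0 _ hp0].
  (* A tail of digits [c - 1] would make the right end points of the intervals around [x] constant,
     equal to [A > x], although they converge to [x]. *)
  have hK n : Num.floor (x * c%:R ^+ (p0 + n)) + 1 =
      (Num.floor (x * c%:R ^+ p0) + 1) * (c ^ n)%:Z.
    elim: n => [|n IH]; first by rewrite addn0 expn0 mulr1.
    rewrite addnS floor_digit hp0 /=; last by rewrite -addnS leq_addr.
    rewrite expnS PoszM [RHS]mulrCA -IH mulrDr mulr1 [X in X + _ + _ = _]mulrC -addrA; congr (_ + _).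
    by rewrite addrC -intS prednK // (ltn_trans _ hc).
  pose A : R := (Num.floor (x * c%:R ^+ p0) + 1)%:~R / c%:R ^+ p0.
  have /andP[_ xA] := floor_itv (x * c%:R ^+ p0).
  have xA' : x < A by rewrite ltr_pdivlMr ?baseX_gt0.
  have cA : ((Num.floor (x * c%:R ^+ n))%:~R / c%:R ^+ n + (c%:R ^+ n)^-1)
      @[n --> \oo] --> x + 0.
    by apply: cvgD; [exact: cvg_floor_adic|exact: cvg_baseVX].
  rewrite addr0 in cA.
  have [N _ hN] := cvgr_lt _ cA _ xA'.
  have := hN (p0 + N)%N (leq_addl _ _); rewrite /= -[X in _ + X < _]mul1r -mulrDl.
  rewrite -[X in _ + X](_ : 1%:~R = 1 :> R) // -intrD hK intrM.
  rewrite -[((c ^ N)%:Z)%:~R]/((c ^ N)%:R) natrX exprD -mulf_div mulfV ?lt0r_neq0 ?baseX_gt0 //.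
  by rewrite mulr1 ltxx.
- exists (Num.floor x).
  have h : ((Num.floor (x * c%:R ^+ n))%:~R / c%:R ^+ n - (Num.floor x)%:~R)
      @[n --> \oo] --> x - (Num.floor x)%:~R.
    by apply: cvgB; [exact: cvg_floor_adic|exact: cvg_cst].
  apply: cvg_trans h; apply: near_eq_cvg; near=> n.
  by rewrite -adic_digit_series.
Unshelve. all: by end_near. Qed.

(** The partial sums [u] increase to [x], and [v = u + c^-n] decreases to [x], strictly at each
    digit other than [c - 1]. As such digits recur, [u n <= x < v n], so the numerator of [u n] is
    the floor of [x c^n]. *)
Lemma is_digit_seq_uniq x (d : nat -> nat) (p : nat) :
  is_digit_seq c x d -> d p.+1 = adic_digit c x p.+1.
Proof.
move=> [dc dne [x0 dx]].
pose K := fix K n : int := if n is m.+1 then K m * c%:Z + (d n)%:Z else x0.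
have KE n : (K n)%:~R / c%:R ^+ n = x0%:~R + [series (d p.+1)%:R / c%:R ^+ p.+1]_p n :> R.
  elim: n => [|n IH]; first by rewrite /series /= big_nil expr0 divr1 addr0.
  rewrite /series /= in IH *; rewrite big_nat_recr //= addrA -IH.
  rewrite intrD intrM mulrDl !exprSr.
  have cn0 := lt0r_neq0 (baseX_gt0 n); have c0 := lt0r_neq0 base_gt0.
  rewrite -[(c%:Z)%:~R]/(c%:R) -[((d n.+1)%:Z)%:~R]/((d n.+1)%:R).
  by field; rewrite cn0 c0.
pose u n : R := (K n)%:~R / c%:R ^+ n.
have ux : u @ \oo --> x.
  have : (x0%:~R + [series (d p.+1)%:R / c%:R ^+ p.+1]_p n) @[n --> \oo] -->
      x0%:~R + (x - x0%:~R).
    by apply: cvgD => //; exact: cvg_cst.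
  rewrite addrC subrK; apply: cvg_trans; apply: near_eq_cvg.
  by near=> n; rewrite /u KE.
pose v n : R := (K n + 1)%:~R / c%:R ^+ n.
have vx : v @ \oo --> x.
  rewrite -[x]addr0 (_ : v = u \+ (fun n => (c%:R ^+ n)^-1)).
    by apply: cvgD => //; exact: cvg_baseVX.
  by apply/funext => n; rewrite /v /u /= intrD mulrDl mul1r.
have cZ : c%:R = (c%:Z)%:~R :> R by [].
have uS n : u n <= u n.+1.
  rewrite /u ler_pdivrMr ?baseX_gt0 // mulrAC ler_pdivlMr ?baseX_gt0 //.
  rewrite exprS mulrCA mulrA ler_wpM2r ?(ltW (baseX_gt0 _)) //.
  by rewrite cZ -intrM (ler_int R) mulrC /= lerDl.
have cP : (c = c.-1.+1)%N by rewrite prednK // (ltn_trans _ hc).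
have vS n : v n.+1 <= v n.
  rewrite /v ler_pdivrMr ?baseX_gt0 // mulrAC ler_pdivlMr ?baseX_gt0 //.
  rewrite exprS mulrA ler_wpM2r ?(ltW (baseX_gt0 _)) //.
  rewrite cZ -intrM (ler_int R) /= mulrDl mul1r -addrA lerD2l.
  by rewrite lezD1 ltz_nat.
have vSlt n : d n.+1 != c.-1 -> v n.+1 < v n.
  move=> dn; rewrite /v ltr_pdivrMr ?baseX_gt0 // mulrAC ltr_pdivlMr ?baseX_gt0 //.
  rewrite exprS mulrA ltr_pM2r ?baseX_gt0 //.
  rewrite cZ -intrM (ltr_int R) /= mulrDl mul1r -addrA ltrD2l.
  rewrite -PoszD ltz_nat addn1 {1}cP ltnS ltn_neqAle dn /=.
  by have := dc n.+1; rewrite {1}cP ltnS.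
have umono : {homo u : n m / (n <= m)%N >-> n <= m} by apply/nondecreasing_seqP.
have vmono : {homo v : n m / (n <= m)%N >-> m <= n} by apply/nonincreasing_seqP.
have limu : limn u = x by apply/cvg_lim.
have limv : limn v = x by apply/cvg_lim.
have cu : cvgn u by apply/cvg_ex; exists x.
have cv : cvgn v by apply/cvg_ex; exists x.
have KF n : Num.floor (x * c%:R ^+ n) = K n.
  apply: floor_def; rewrite -ler_pdivrMr ?baseX_gt0 // -ltr_pdivlMr ?baseX_gt0 //.
  rewrite -{1}limu (nondecreasing_cvgn_le umono cu) /=.
  have [m nm dm] : exists2 m, (n <= m)%N & d m.+1 != c.-1.
    apply: contrapT => no; apply: dne; exists n.+1 => // m /= nm.
    apply: contrapT => dm; apply: no; exists m.-1.
      by rewrite -ltnS prednK // (leq_trans _ nm).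
    by rewrite prednK ?(leq_trans _ nm) //; apply/eqP.
  apply: lt_le_trans (vmono _ _ nm); apply: le_lt_trans (vSlt _ dm).
  by rewrite -limv; exact: nonincreasing_cvgn_ge.
have := floor_digit x p; rewrite !KF /= => /addrI [].
by [].
Unshelve. all: by end_near. Qed.

Lemma digitE x (p : nat) : digit c x p.+1 = adic_digit c x p.+1.
Proof.
apply: is_digit_seq_uniq; rewrite /digit; apply: getPex.
by exists (adic_digit c x); exact: is_digit_seq_adic.
Qed.

(** Pigeonhole: two of the [Q + 1] fractional parts of [i x], [0 <= i <= Q], fall into the same one
    of [Q] boxes. Cancelling the common factor keeps the fraction and can only enlarge the
    right-hand bound. *)
Lemma dirichlet x (Q : nat) : (0 < Q)%N ->
  exists p : int, exists q : nat,
    [/\ (0 < q <= Q)%N, coprimez p q%:Z & `|x - p%:~R / q%:R| <= (q%:R * Q%:R)^-1].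
Proof.
move=> Q0; have Q0' : 0 < Q%:R :> R by rewrite ltr0n.
pose fr (i : nat) : R := i%:R * x - (Num.floor (i%:R * x))%:~R.
have fr0 i : 0 <= fr i by rewrite subr_ge0; case/andP: (floor_itv (i%:R * x)).
have fr1 i : fr i < 1.
  by case/andP: (floor_itv (i%:R * x)) => _; rewrite intrD /fr; lra.
have frQ0 i : 0 <= Q%:R * fr i by rewrite mulr_ge0 // ltW.
have frQ i : (Num.truncn (Q%:R * fr i) < Q)%N.
  rewrite -(ltr_nat R); have /andP[h _] := truncn_itv (frQ0 i).
  by apply: le_lt_trans h _; rewrite -[ltRHS]mulr1 ltr_pM2l.
pose F (i : 'I_Q.+1) : 'I_Q := Ordinal (frQ i).
have [i [j [ij FE]]] : exists i j : 'I_Q.+1, (i < j)%N /\ F i = F j.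
  have /injectiveP : ~~ injectiveb F.
    by apply/injectiveP => /leq_card; rewrite !card_ord ltnn.
  move=> ninj; apply: contrapT => no; apply: ninj => i j FE.
  apply/val_inj; case: (ltngtP i j) => // ij; exfalso; apply: no.
    by exists i, j.
  by exists j, i.
have trE : Num.truncn (Q%:R * fr i) = Num.truncn (Q%:R * fr j) by case: FE.
pose q := (j - i)%N; pose p := Num.floor (j%:R * x) - Num.floor (i%:R * x).
have q0 : (0 < q)%N by rewrite subn_gt0.
have qQ : (q <= Q)%N by rewrite (leq_trans (leq_subr _ _)) // -ltnS.
have q0' : 0 < q%:R :> R by rewrite ltr0n.
have close : `|q%:R * x - p%:~R| <= Q%:R^-1.
  have -> : q%:R * x - p%:~R = fr j - fr i.
    have -> : q%:R = j%:R - i%:R :> R by rewrite natrB // ltnW.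
    have -> : p%:~R = (Num.floor (j%:R * x))%:~R - (Num.floor (i%:R * x))%:~R :> R.
      by rewrite intrB.
    by rewrite /fr; move: (_%:~R : R) (_%:~R : R) => a b; ring.
  have /andP[h1 h2] := truncn_itv (frQ0 i); have /andP[] := truncn_itv (frQ0 j).
  rewrite -trE => h3 h4.
  rewrite -[Q%:R^-1]mul1r ler_pdivlMr // -[X in _ * X]gtr0_norm // -normrM ler_norml.
  rewrite -natr1 in h2 h4.
  by apply/andP; split; lra.
pose g := gcdn `|p| q.
have g0 : (0 < g)%N by rewrite gcdn_gt0 q0 orbT.
exists (p %/ g%:Z)%Z, (q %/ g)%N.
have gq : (g %| q)%N by exact: dvdn_gcdr.
have gp : (g%:Z %| p)%Z by rewrite dvdzE /= dvdn_gcdl.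
have q1 : (0 < q %/ g)%N by rewrite divn_gt0 // dvdn_leq.
split.
- by rewrite q1 (leq_trans (leq_div _ _)).
- have pE : (`|p| = `|(p %/ g%:Z)%Z| * g)%N by rewrite -[in LHS](divzK gp) abszM.
  have : (gcdn `|p| q = gcdn `|(p %/ g%:Z)%Z| (q %/ g) * g)%N.
    by rewrite muln_gcdl -pE divnK.
  rewrite coprimezE /= /coprime -/g -[LHS]mul1n => /eqP.
  by rewrite eqn_pmul2r // eq_sym.
- have pE : p = (p %/ g%:Z)%Z * g%:Z by rewrite divzK.
  have qE : q = (q %/ g * g)%N by rewrite divnK.
  have g0' : g%:R != 0 :> R by rewrite pnatr_eq0 -lt0n.
  have frE : p%:~R / q%:R = (p %/ g%:Z)%Z%:~R / (q %/ g)%N%:R :> R.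
    rewrite {1}pE {1}qE natrM intrM -[(g%:Z)%:~R]/(g%:R).
    by rewrite -mulf_div mulfV // mulr1.
  rewrite -frE.
  have -> : x - p%:~R / q%:R = (q%:R * x - p%:~R) / q%:R.
    by field; rewrite lt0r_neq0.
  rewrite normrM [`|q%:R^-1|]gtr0_norm ?invr_gt0 //.
  rewrite invfM mulrC; apply: ler_pM => //.
  by rewrite lef_pV2 ?posrE ?ltr0n // ler_nat leq_div.
Qed.
End Adic.

(** * Gauge functions *)

Section Gauges.
Variable (R : realType).
Implicit Types g : R -> R.

Lemma gauge_upto_le g (e e' : R) : e' <= e -> gauge_upto g e -> gauge_upto g e'.
Proof.
move=> ee' [h1 h2 h3 h4].
have sub0 r : r \in `[0, e'] -> r \in `[0, e].
  by rewrite !in_itv /= => /andP[-> /le_trans]; apply.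
have sub1 r : r \in `]0, e'] -> r \in `]0, e].
  by rewrite !in_itv /= => /andP[-> /le_trans]; apply.
split.
- apply: continuous_subspaceW h1 => r /=; rewrite !in_itv /=.
  by move=> /andP[-> /le_trans]; apply.
- by move=> x y /sub0 x0 /sub0 y0; apply: h2.
- by move=> x /sub1 x0; apply: h3.
- by move=> x y /sub1 x0 /sub1 y0; apply: h4.
Qed.

Lemma gauge_radius_gt g (r : R) : gauge g -> r < gauge_radius g ->
  exists2 e, r < e & gauge_upto g e.
Proof.
move=> [_ [e e0 ge]] rlt.
have S0 : has_sup [set e | 0 < e <= 1 /\ gauge_upto g e].
  split; last by exists 1 => y /= [/andP[]].
  exists (Num.min e 1); split; first by rewrite lt_min e0 ltr01 ge_min lexx orbT.
  by apply: gauge_upto_le ge; rewrite ge_min lexx.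
have [e' [_ ge'] re'] := sup_adherent (etrans (subr_gt0 _ _) rlt) S0.
by exists e' => //; apply: le_lt_trans re'; rewrite /gauge_radius; lra.
Qed.

Lemma gauge_radius_gt0 g : gauge g -> 0 < gauge_radius g.
Proof.
move=> [_ [e e0 ge]].
apply: (@lt_le_trans _ _ (Num.min e 1)); first by rewrite lt_min e0 ltr01.
apply: sup_upper_bound.
  split; last by exists 1 => y /= [/andP[]].
  exists (Num.min e 1); split; first by rewrite lt_min e0 ltr01 ge_min lexx orbT.
  by apply: gauge_upto_le ge; rewrite ge_min lexx.
split; first by rewrite lt_min e0 ltr01 ge_min lexx orbT.
by apply: gauge_upto_le ge; rewrite ge_min lexx.
Qed.

Lemma gauge_radius_le1 g : gauge_radius g <= 1.
Proof.
have [ne|/nonemptyPn e] := pselect ([set e | 0 < e <= 1 /\ gauge_upto g e] !=set0).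
  by apply: ge_sup => // y /= [/andP[]].
by rewrite /gauge_radius e sup0.
Qed.

Lemma gauge_gt0 g (r : R) : gauge g -> 0 < r -> r < gauge_radius g -> 0 < g r.
Proof.
move=> gg r0 /(gauge_radius_gt gg)[e re [_ _ h _]].
have : 0 < g r / r by apply: h; rewrite in_itv /= r0 ltW.
by move=> h'; have := mulr_gt0 h' r0; rewrite divfK ?gt_eqF.
Qed.

Lemma gauge_nondecreasing g (r s : R) : gauge g -> 0 <= r -> r <= s ->
  s < gauge_radius g -> g r <= g s.
Proof.
move=> gg r0 rs /(gauge_radius_gt gg)[e se [_ h _ _]].
by apply: h => //; rewrite in_itv /= ?r0 ?(le_trans r0 rs) ?(ltW se) ?(le_trans rs (ltW se)).
Qed.

Lemma gauge_ratio_nonincreasing g (r s : R) : gauge g -> 0 < r -> r <= s ->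
  s < gauge_radius g -> g s / s <= g r / r.
Proof.
move=> gg r0 rs /(gauge_radius_gt gg)[e se [_ _ _ h]].
by apply: h => //; rewrite in_itv /= ?r0 ?(lt_le_trans r0 rs) ?(ltW se) ?(le_trans rs (ltW se)).
Qed.

(** With [L = N ln c], the factor [r^(-3 f)] becomes [expR (3 L^(eta + 7/8))]; this sublinear
    surplus in the exponent later pays for constants and fluctuations. *)
Lemma hgaugeE (c : nat) (s eta : R) (N : nat) : (1 < c)%N -> (0 < N)%N ->
  hgauge s (fun r => 3 * f_eta eta r) (c%:R ^- N) =
  expR (- (s * (N%:R * ln c%:R)) + 3 * (N%:R * ln c%:R) `^ (eta + 7 / 8)).
Proof.
move=> hc N0; have c0 : 0 < c%:R :> R by rewrite ltr0n ltnW.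
have cN0 : 0 < c%:R ^- N :> R by rewrite invr_gt0 exprn_gt0.
rewrite /hgauge gt_eqF // [LHS]/powR gt_eqF // lnV ?posrE ?exprn_gt0 // lnXn //.
rewrite /f_eta lnV ?posrE ?exprn_gt0 // lnXn // opprK -[ln c%:R *+ N]mulr_natl.
set L := _ * ln _.
have L0 : 0 < L by rewrite mulr_gt0 ?ltr0n // ln_gt0 // ltr1n.
have -> : eta + 7 / 8 = (eta - 1 / 8) + 1 by lra.
have -> : L `^ (eta - 1 / 8 + 1) = L `^ (eta - 1 / 8) * L.
  by rewrite powRD ?powRr1 ?ltW // (gt_eqF L0) implybT.
by congr expR; ring.
Qed.

Lemma gauge_prec_ge (c : nat) g h : (1 < c)%N -> gauge_prec g h ->
  (forall N, (0 < N)%N -> 0 < h (c%:R ^- N)) ->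
  exists N0, forall N, (N0 <= N)%N -> h (c%:R ^- N) <= g (c%:R ^- N).
Proof.
move=> hc [_ /cvgryPge/(_ 1) [e /= e0 he]] h0.
have := @cvg_baseVX R c hc => /cvgr_lt/(_ _ e0)[N0 _ hN0].
exists N0.+1 => N NN0.
have N0' : (0 < N)%N by rewrite (leq_trans _ NN0).
have cN0 : 0 < c%:R ^- N :> R by rewrite invr_gt0 exprn_gt0 // ltr0n ltnW.
have : 1 <= g (c%:R ^- N) / h (c%:R ^- N).
  apply: he => //=; rewrite sub0r normrN gtr0_norm //.
  by apply: hN0; rewrite /= ltnW.
by rewrite ler_pdivlMr ?mul1r // h0.
Qed.

(** With [y = x^(1/4)] one has [sqrt x = y^2] and [ln x <= 4 y], so the left side is at most
    [(|C| + 17 B) y^3]. The further factor [x^(gamma - 3/4)] on the right exceeds any constant from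
    some [k0] on. *)
Lemma sqrt_ln_le_powR (C B L gamma : R) : 0 <= B -> 0 < L -> 3 / 4 < gamma ->
  exists2 k0 : nat, (0 < k0)%N & forall x : nat, (k0 <= x)%N ->
    C + B * Num.sqrt x%:R * (1 + 4 * ln x%:R) <= 3 * (x%:R * L) `^ gamma.
Proof.
move=> B0 L0 hg; pose delta := gamma - 3 / 4.
have d0 : 0 < delta by rewrite subr_gt0.
have Lg0 : 0 < L `^ gamma by rewrite powR_gt0.
pose D := (`|C| + 17 * B) / (3 * L `^ gamma).
have D0 : 0 <= D by rewrite divr_ge0 ?addr_ge0 ?mulr_ge0 // ltW.
exists (Num.truncn (D `^ delta^-1)).+1 => // x kx.
have x0 : (0 < x)%N by rewrite (leq_trans _ kx).
have x0' : 0 < x%:R :> R by rewrite ltr0n.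
have x1 : 1 <= x%:R :> R by rewrite ler1n.
pose y : R := x%:R `^ (1 / 4).
have y1 : 1 <= y.
  have <- : (1 : R) `^ (1 / 4) = 1 by rewrite powR1.
    by rewrite ge0_ler_powR ?nnegrE //; lra.
have yX n : y ^+ n = x%:R `^ (n%:R / 4).
  by rewrite -powR_mulrn ?powR_ge0 // /y -powRrM; congr (_ `^ _); lra.
have sq : Num.sqrt x%:R = y ^+ 2.
  by rewrite -powR12_sqrt ?ltW // yX; congr (_ `^ _); lra.
have lny : ln x%:R <= 4 * y.
  have -> : ln x%:R = 4 * ln y by rewrite /y ln_powR; lra.
  by rewrite ler_pM2l // ltW // ln_sublinear // (lt_le_trans ltr01).
have Dx : D <= x%:R `^ delta.
  have -> : D = (D `^ delta^-1) `^ delta.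
    by rewrite -powRrM mulVf ?gt_eqF // powRr1.
  apply: ge0_ler_powR; rewrite ?nnegrE ?powR_ge0 ?ltW //.
  have /andP[_ h] := truncn_itv (powR_ge0 D delta^-1).
  by apply: (lt_le_trans h); rewrite ler_nat.
have -> : (x%:R * L) `^ gamma = x%:R `^ delta * y ^+ 3 * L `^ gamma.
  rewrite powRM ?ltW // yX -powRD; last by rewrite (gt_eqF x0') implybT.
  by congr (_ `^ _ * _); rewrite /delta; lra.
apply: (@le_trans _ _ ((`|C| + 17 * B) * y ^+ 3)).
  have h1 : C <= `|C| * y ^+ 3.
    by rewrite (le_trans (ler_norm _)) // ler_peMr // exprn_ege1.
  have h2 : B * Num.sqrt x%:R * (1 + 4 * ln x%:R) <= 17 * B * y ^+ 3.
    have -> : 17 * B * y ^+ 3 = B * y ^+ 2 * (17 * y) by ring.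
    by rewrite sq ler_wpM2l ?mulr_ge0 ?sqr_ge0 //; lra.
  by rewrite mulrDl; lra.
have -> : `|C| + 17 * B = D * (3 * L `^ gamma) by rewrite /D divfK // gt_eqF // mulr_gt0.
have -> : 3 * (x%:R `^ delta * y ^+ 3 * L `^ gamma) = x%:R `^ delta * (3 * L `^ gamma) * y ^+ 3 by ring.
rewrite ler_wpM2r ?exprn_ge0 //; first by rewrite (le_trans ler01).
by rewrite ler_wpM2r // mulr_ge0 // ltW.
Qed.

End Gauges.

(** * Words close to fractions with small denominators *)

Section UnionBound.
Variable (R : realType).

Lemma sum_has_le (I : Type) (n : nat) (F : nat -> R) (r : seq I) (A : I -> pred nat) :
  (forall y, 0 <= F y) ->
  \sum_(0 <= y < n | has (A ^~ y) r) F y <=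
    \sum_(i <- r) \sum_(0 <= y < n | A i y) F y.
Proof.
move=> F0; elim: r => [|i r IH]; first by rewrite big_nil big1.
rewrite big_cons; apply: le_trans (lerD (lexx _) IH).
rewrite big_mkcond [X in X + _]big_mkcond [X in _ + X]big_mkcond -big_split /=.
apply: ler_sum => y _; case: (A i y) => /=; case: ifP => _; rewrite ?addr0 ?add0r //.
by rewrite lerDl.
Qed.

Lemma sum_geometric_le (rho : R) (n : nat) : 0 <= rho -> rho < 1 ->
  \sum_(0 <= i < n) rho ^+ i <= (1 - rho)^-1.
Proof.
move=> r0 r1; have d0 : 0 < 1 - rho by lra.
rewrite -[leRHS]mul1r ler_pdivlMr // big_mkord mulrC.
have := subrX1 rho n; have : 0 <= rho ^+ n by rewrite exprn_ge0.
by lra.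
Qed.

(** Telescoping with [x^-2 <= 2/x - 2/(x+1)] for [x >= 1]. *)
Lemma sum_inv_sqr_le (k n : nat) : (0 < k)%N ->
  \sum_(0 <= l < n) ((k + l)%:R ^- 2 : R) <= 2 / k%:R.
Proof.
move=> k0; have kl l : 0 < (k + l)%:R :> R by rewrite ltr0n addn_gt0 k0.
suff h : \sum_(0 <= l < n) ((k + l)%:R ^- 2 : R) <= 2 / k%:R - 2 / (k + n)%:R.
  by apply: le_trans h _; rewrite lerBlDr lerDl divr_ge0 // ltW.
elim: n => [|n IH]; first by rewrite big_nil addn0 subrr.
rewrite big_nat_recr //= addnS -[((k + n).+1)%:R]natr1; set x : R := (k + n)%:R in IH *.
have x1 : 1 <= x by rewrite /x ler1n addn_gt0 k0.
have x0 : 0 < x by apply: kl.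
have : x ^- 2 <= 2 / x - 2 / (x + 1).
  have -> : 2 / x - 2 / (x + 1) = 2 / (x * (x + 1)).
    by field; rewrite !gt_eqF //; lra.
  rewrite ler_pdivlMr; last by rewrite mulr_gt0 //; lra.
  rewrite mulrC ler_pdivrMr ?exprn_gt0 // expr2.
  have : x * 1 <= x * x by rewrite ler_pM2l.
  by lra.
by lra.
Qed.

End UnionBound.

(* Center of the [y]-th subinterval of generation [n + M] inside
   [[K c^-n, (K+1) c^-n)]. *)
Definition word_center {R : realType} (c n : nat) (K : int) (M y : nat) : R :=
  ((K * (c ^ M)%:Z + y%:Z)%:~R + 1 / 2) / c%:R ^+ (n + M).

(** The bound is that of [dirichlet] with [Q = c^J]: for a word outside this set, the fraction which
    Dirichlet's theorem attaches to its center has denominator at least [D]. *)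
Definition near_small_fraction {R : realType} (c n : nat) (K : int) (M J D : nat) (y : nat) : bool :=
  `[< exists p : int, exists q : nat,
      [/\ (0 < q)%N, (q < D)%N &
       `|word_center c n K M y - p%:~R / q%:R| <= ((q%:R * c%:R ^+ J)^-1 : R)] >].

Section GoodWords.
Variables (R : realType) (c : nat) (P : nat -> R) (rho : R).
Hypothesis hc : (1 < c)%N.
Hypothesis P0 : forall b, 0 <= P b.
Hypothesis P1 : \sum_(0 <= b < c) P b = 1.
Hypothesis Prho : forall b, P b <= rho.

Lemma word_center_dist (n : nat) (K : int) (M y y' : nat) :
  word_center c n K M y - word_center c n K M y' =
  (y%:R - y'%:R) / c%:R ^+ (n + M) :> R.
Proof. by rewrite /word_center -mulrBl !intrD -!pmulrn; congr (_ / _); ring. Qed.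

Lemma fractions_separated (p p' : int) (q q' : nat) : (0 < q)%N -> (0 < q')%N ->
  p%:~R / q%:R != p'%:~R / q'%:R :> R ->
  (q%:R * q'%:R)^-1 <= `|p%:~R / q%:R - p'%:~R / q'%:R| :> R.
Proof.
move=> q0 q'0 ne; have Q0 : 0 < q%:R :> R by rewrite ltr0n.
have Q'0 : 0 < q'%:R :> R by rewrite ltr0n.
have E : p%:~R / q%:R - p'%:~R / q'%:R = (p * q'%:Z - p' * q%:Z)%:~R / (q%:R * q'%:R) :> R.
  rewrite intrB !intrM -[(q%:Z)%:~R]/(q%:R) -[(q'%:Z)%:~R]/(q'%:R).
  by field; rewrite !gt_eqF.
rewrite E normrM [`|(q%:R * _)^-1|]gtr0_norm ?invr_gt0 ?mulr_gt0 //.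
rewrite ler_peMl ?invr_ge0 ?mulr_ge0 ?ler0n //.
rewrite -intr_norm -[1]/(1%:~R) (ler_int R) -gtz0_ge1 normr_gt0.
apply: contra ne => /eqP z; rewrite -subr_eq0 E z mul0r //.
Qed.

(** Two words with the same first [e] letters have centers closer than [c^-(2a+3)], so their
    fractions are closer than [c^-(2a+2)], which distinct fractions with denominators below
    [c^(a+1)] cannot be. Both centers are then near one fraction, so the words differ by at most
    [c^g], and [sum_wprod_concentrated] applies. *)
Lemma sum_wprod_near_fraction_level (n : nat) (K : int) (M J s a : nat) :
  (n + M + s + 5 = J.*2)%N -> (n + 1 <= J)%N -> (a + s + 3 < J)%N ->
  \sum_(0 <= y < c ^ M | `[< exists p : int, exists q : nat,
      [/\ (0 < q)%N, (c ^ a <= q)%N, (q < c ^ a.+1)%N &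
       `|word_center c n K M y - p%:~R / q%:R| <= ((q%:R * c%:R ^+ J)^-1 : R)] >])
    wprod P c M y <= 2 * (rho ^+ (J - a - 4) + rho ^+ (a + J - 1 - n)).
Proof.
move=> eM nJ aJ; have c0 : (0 < c)%N by rewrite ltnW.
have rho0 : 0 <= rho by apply: le_trans (Prho 0%N).
(* [e] is the least length with [n + e >= 2a + 3], and [g] satisfies [n + M - g = a + J - 1]. The
   truncated subtraction gives [e = 0] for [n >= 2a + 3], whence the two possible values of [f]. *)
pose e := (2 * a + 3 - n)%N; pose f := (a + J - 1 - n - e)%N.
pose g := (M - e - f)%N.
have eMs : M = (e + f + g)%N by rewrite /g /f /e; lia.
have gE : (n + M - g = a + J - 1)%N by rewrite /g /f /e; lia.
have fE : f = (J - a - 4)%N \/ f = (a + J - 1 - n)%N by rewrite /f /e; lia.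
have ne : (2 * a + 3 <= n + e)%N by rewrite /e; lia.
have aJ4 : (a + 4 <= J)%N by lia.
apply: (@le_trans _ _ (2 * rho ^+ f)); last first.
  apply: ler_wpM2l => //; case: fE => ->.
    by rewrite lerDl exprn_ge0.
  by rewrite lerDr exprn_ge0.
clear fE.
rewrite eMs; apply: sum_wprod_concentrated => // y y' _ _.
rewrite -eMs => /asboolP[p [q [q0 aq qa close]]] /asboolP[p' [q' [q'0 aq' qa' close']]] yy'.
have cX m : 0 < c%:R ^+ m :> R by apply: baseX_gt0.
have c1 : 1 <= c%:R :> R by rewrite ler1n.
have c2 : 2 <= c%:R :> R by rewrite (ler_nat R 2).
have cl (qq : nat) : (c ^ a <= qq)%N -> (qq%:R * c%:R ^+ J)^-1 <= c%:R ^- (a + J) :> R.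
  move=> aqq; rewrite lef_pV2 ?posrE ?mulr_gt0 ?cX //; last first.
    by rewrite ltr0n (leq_trans _ aqq) // expn_gt0 c0.
  by rewrite exprD ler_wpM2r ?(ltW (cX _)) // -natrX ler_nat.
have {}close := le_trans close (cl _ aq).
have {}close' := le_trans close' (cl _ aq').
have dist0 : `|y%:R - y'%:R| < c%:R ^+ (f + g) :> R.
  have D0 : (0 < c ^ (f + g))%N by rewrite expn_gt0 c0.
  have := ltn_pmod y D0; have := ltn_pmod y' D0.
  have := divn_eq y (c ^ (f + g)); have := divn_eq y' (c ^ (f + g)).
  rewrite yy'; set z := (y' %/ _)%N; set r := (y %% _)%N; set r' := (y' %% _)%N.
  move=> -> ->; rewrite -!(ltr_nat R) natrX => h1 h2.
  have r0 : 0 <= r%:R :> R by rewrite ler0n.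
  have r'0 : 0 <= r'%:R :> R by rewrite ler0n.
  by rewrite !natrD ltr_norml; apply/andP; split; lra.
have dist1 : `|word_center c n K M y - word_center c n K M y'| < c%:R ^- (2 * a + 3) :> R.
  rewrite word_center_dist normrM [`|_^-1|]gtr0_norm ?invr_gt0 //.
  rewrite ltr_pdivrMr //; apply: (lt_le_trans dist0).
  rewrite ler_pdivlMl // -exprD ler_weXn2l //.
  by clear -eMs ne; lia.
have closeB : c%:R ^- (a + J) * 2 <= c%:R ^- (2 * a + 3) :> R.
  rewrite ler_pdivrMl // ler_pdivlMr // mulrC.
  apply: (@le_trans _ _ (c%:R ^+ (2 * a + 3) * c%:R)); first by rewrite ler_wpM2l ?(ltW (cX _)).
  by rewrite -exprSr ler_weXn2l //; clear -aJ4; lia.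
have feq : p%:~R / q%:R = p'%:~R / q'%:R :> R.
  apply/eqP; apply: contraT => /(fractions_separated q0 q'0) sep.
  have h1 : c%:R ^- (2 * a + 2) < (q%:R * q'%:R)^-1 :> R.
    rewrite ltf_pV2 ?posrE ?mulr_gt0 ?ltr0n //.
    have -> : (2 * a + 2 = a.+1 + a.+1)%N by clear; lia.
    rewrite exprD -!natrX; apply: ltr_pM; by rewrite ?ler0n ?ltr_nat.
  have E2 : c%:R ^- (2 * a + 2) = c%:R ^- (2 * a + 3) * c%:R :> R.
    have -> : (2 * a + 3 = (2 * a + 2).+1)%N by clear; lia.
    by rewrite exprSr invfM mulrAC -mulrA mulfV ?mulr1 // gt_eqF // ltr0n.
  have b0 : 0 < c%:R ^- (2 * a + 3) :> R by rewrite invr_gt0.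
  have h2 : c%:R ^- (2 * a + 3) * 2 <= c%:R ^- (2 * a + 3) * c%:R :> R by rewrite ler_pM2l.
  have tri := ler_distD (@word_center R c n K M y) (p%:~R / q%:R) (p'%:~R / q'%:R).
  have tri' := ler_distD (@word_center R c n K M y') (@word_center R c n K M y) (p'%:~R / q'%:R).
  rewrite distrC in close.
  have absurd (x1 x2 x3 x4 x5 u v b bc d : R) : v <= x1 -> u < v -> u = bc ->
      b * 2 <= bc -> x1 <= x2 + x3 -> x3 <= x4 + x5 -> x2 <= d -> x5 <= d ->
      x4 < b -> d * 2 <= b -> False by lra.
  by case: (absurd _ _ _ _ _ _ _ _ _ _ sep h1 E2 h2 tri tri' close close' dist1 closeB).
rewrite -feq in close'.
have dist2 : `|y%:R - y'%:R| <= c%:R ^+ g :> R.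
  have tri := ler_distD (p%:~R / q%:R) (@word_center R c n K M y) (@word_center R c n K M y').
  rewrite word_center_dist normrM [`|_^-1|]gtr0_norm ?invr_gt0 // in tri.
  rewrite distrC in close'.
  have : `|y%:R - y'%:R| / c%:R ^+ (n + M) <= c%:R ^- (a + J - 1) :> R.
    apply: (le_trans tri); apply: (le_trans (lerD close close')).
    apply: (@le_trans _ _ (c%:R ^- (a + J) * 2)); first by rewrite [leRHS]mulr_natr mulr2n.
    rewrite ler_pdivrMl // ler_pdivlMr // mulrC.
    apply: (@le_trans _ _ (c%:R ^+ (a + J - 1) * c%:R)); first by rewrite ler_wpM2l ?(ltW (cX _)).
    by rewrite -exprSr ler_weXn2l //; clear -aJ4; lia.
  rewrite ler_pdivrMr // ler_pdivlMl // => h.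
  rewrite -(ler_pM2l (cX (a + J - 1)%N)); apply: (le_trans h).
  rewrite -exprD ler_weXn2l //; by clear -gE eMs; lia.
have g0 : (0 < c ^ g)%N by rewrite expn_gt0 c0.
have -> : ((y' %/ c ^ g).+1 = (y' + c ^ g) %/ c ^ g)%N.
  by rewrite divnDr ?dvdnn // divnn g0 addn1.
apply: leq_div2r; rewrite -(ler_nat R) natrD natrX.
have := ler_norm (y%:R - y'%:R : R); lra.
Qed.

(** Sorting the denominators by [a = trunc_log c q] leaves two geometric series, both with exponents
    at least [s]. *)
Lemma sum_wprod_near_small_fraction (n : nat) (K : int) (M J s : nat) :
  rho < 1 -> (n + M + s + 5 = J.*2)%N -> (n + 1 + s <= J)%N ->
  \sum_(0 <= y < c ^ M | @near_small_fraction R c n K M J (c ^ (J - s - 3)) y)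
    wprod P c M y <= 4 * rho ^+ s / (1 - rho).
Proof.
move=> rho1 eM nJ; have c0 : (0 < c)%N by rewrite ltnW.
have rho0 : 0 <= rho by apply: le_trans (Prho 0%N).
pose A (a y : nat) := `[< exists p : int, exists q : nat,
      [/\ (0 < q)%N, (c ^ a <= q)%N, (q < c ^ a.+1)%N &
       `|word_center c n K M y - p%:~R / q%:R| <= ((q%:R * c%:R ^+ J)^-1 : R)] >].
pose T := (J - s - 3)%N.
apply: (@le_trans _ _ (\sum_(0 <= y < c ^ M | has (A ^~ y) (iota 0 T)) wprod P c M y)).
  rewrite big_mkcond [leRHS]big_mkcond; apply: ler_sum => y _.
  case: ifP => [/asboolP[p [q [q0 qJ close]]]|_]; last by case: ifP => // _; exact: wprod_ge0.
  rewrite ifT //; apply/hasP; exists (trunc_log c q).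
    rewrite mem_iota /= add0n -(ltn_exp2l _ _ hc); apply: leq_ltn_trans qJ.
    by have /andP[] := trunc_log_bounds hc q0.
  by apply/asboolP; exists p, q; have /andP[] := trunc_log_bounds hc q0.
apply: le_trans (sum_has_le _ _ _ _) _; first by move=> y; exact: wprod_ge0.
have -> : iota 0 T = index_iota 0 T by rewrite /index_iota subn0.
apply: (@le_trans _ _ (\sum_(0 <= a < T) 2 * (rho ^+ s * rho ^+ (T - a.+1) + rho ^+ s * rho ^+ a))).
  rewrite big_nat [leRHS]big_nat; apply: ler_sum => a /= aT.
  have aT' : (a < J - s - 3)%N by exact: aT.
  apply: le_trans (sum_wprod_near_fraction_level K eM _ _) _; [lia|lia|].
  rewrite ler_pM2l // -!exprD lerD //.
    by have -> : (J - a - 4 = s + (T - a.+1))%N by rewrite /T; lia.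
  by rewrite ler_wiXn2l ?(ltW rho1) //; lia.
rewrite -mulr_sumr big_split /= -!mulr_sumr.
have -> : \sum_(0 <= a < T) rho ^+ (T - a.+1) = \sum_(0 <= a < T) rho ^+ a.
  by rewrite [RHS]big_nat_rev /= add0n.
have := sum_geometric_le T rho0 rho1; set S := \sum_(0 <= _ < _) _ => hS.
have : rho ^+ s * S <= rho ^+ s * (1 - rho)^-1 by rewrite ler_wpM2l ?exprn_ge0.
by lra.
Qed.

End GoodWords.

(** * Weight of the good words *)

Definition nat_entropy {R : realType} (c : nat) (P : nat -> R) : R :=
  - \sum_(0 <= b < c) P b * ln (P b).

(** Allowed excess of the log-weight of a prefix of length [l], taken at [x = k + l]: large enough
    for a Chernoff bound [x^-2], summable over [l], yet of order [x^(1/2) ln x], below the surplus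
    of the gauge. *)
Definition fluctuation {R : realType} (B : R) (x : nat) : R :=
  B * Num.sqrt x%:R * (1 + 4 * ln x%:R).

Definition good_word {R : realType} (c : nat) (P : nat -> R) (B delta : R)
    (n : nat) (K : int) (M J s k : nat) (y : nat) : bool :=
  [&& all (fun l => wprod P c l (y %/ c ^ (M - l)) <=
        expR (- (l%:R * nat_entropy c P) + fluctuation B (k + l))) (iota 0 M.+1),
      all (fun b => `|dsum (fun d => (d == b)%:R) c M y - M%:R * P b| <= delta * M%:R)
        (iota 0 c)
    & ~~ @near_small_fraction R c n K M J (c ^ (J - s - 3)) y].

Section GoodWordsWeight.
Variables (R : realType) (c : nat) (P : nat -> R) (rho : R).
Hypothesis hc : (1 < c)%N.
Hypothesis P0 : forall b, 0 <= P b.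
Hypothesis Ppos : forall b, (b < c)%N -> 0 < P b.
Hypothesis P1 : \sum_(0 <= b < c) P b = 1.
Hypothesis Prho : forall b, P b <= rho.
Hypothesis rho1 : rho < 1.
Local Notation H := (nat_entropy c P).

Lemma wprod_expR (l z : nat) :
  wprod P c l z = expR (dsum (fun b => ln (P b) + H) c l z - l%:R * H).
Proof.
rewrite /dsum big_split /= sumr_const card_ord -[H *+ l]mulr_natl addrK.
rewrite expR_sum; apply: eq_bigr => i _; rewrite lnK // posrE Ppos //.
by rewrite ltn_mod ltnW.
Qed.

Lemma sum_wprod_heavy (B : R) (k M : nat) : (0 < k)%N -> 0 < B ->
  (forall b, (b < c)%N -> `|ln (P b) + H| <= B) ->
  \sum_(0 <= y < c ^ M | has (fun l => expR (- (l%:R * H) + fluctuation B (k + l))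
      < wprod P c l (y %/ c ^ (M - l))) (iota 0 M.+1)) wprod P c M y <= 2 / k%:R.
Proof.
move=> k0 B0 fB.
apply: le_trans (sum_has_le _ _ (fun l y => expR (- (l%:R * H) + fluctuation B (k + l))
  < wprod P c l (y %/ c ^ (M - l))) _) _; first by move=> y; exact: wprod_ge0.
apply: le_trans (sum_inv_sqr_le R M.+1 k0).
rewrite -[X in iota _ X]subn0 -/(index_iota 0 M.+1) big_nat [leRHS]big_nat.
apply: ler_sum => l /=; rewrite ltnS => lM.
have := sum_wprod_marginal hc P1 l (M - l) (fun z =>
  expR (- (l%:R * H) + fluctuation B (k + l)) < wprod P c l z).
rewrite subnKC // => ->.
have x0 : 0 < (k + l)%:R :> R by rewrite ltr0n addn_gt0 k0.
have s0 : 0 < Num.sqrt ((k + l)%:R : R) by rewrite sqrtr_gt0.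
(* With this [theta] the quadratic term is at most 1/2 and the linear term equals
   [1/2 + 2 ln (k + l)], which leaves [(k + l)^-2]. *)
pose theta := (2 * B * Num.sqrt ((k + l)%:R : R))^-1.
have th0 : 0 <= theta by rewrite invr_ge0 ?mulr_ge0 // ltW.
have thB : theta * B = (2 * Num.sqrt ((k + l)%:R : R))^-1.
  by rewrite /theta; field; rewrite !gt_eqF.
have f0 : \sum_(0 <= b < c) P b * (ln (P b) + H) = 0.
  under eq_bigr do rewrite mulrDr.
  by rewrite big_split /= -mulr_suml P1 mul1r /nat_entropy subrr.
have thB2 : theta * B <= 1 / 2.
  rewrite thB invfM div1r ger_pMr ?invr_gt0 // invf_le1 //.
  by rewrite -[leLHS]sqrtr1; apply: ler_wsqrtr; rewrite (ler_nat R 1) addn_gt0 k0.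
apply: le_trans (le_trans (chernoff hc P0 P1 (fluctuation B (k + l)) l fB f0 th0 thB2) _).
  rewrite big_mkcond [leRHS]big_mkcond; apply: ler_sum => z _.
  case: ifP => [h|_]; last by case: ifP => // _; exact: wprod_ge0.
  rewrite ifT //; move: h; rewrite wprod_expR ltr_expR.
  by rewrite addrC ltrD2r => /ltW.
have -> : (k + l)%:R ^- 2 = expR (- (2 * ln (k + l)%:R)) :> R.
  by rewrite expRN (expRM_natl 2) lnK // posrE.
rewrite ler_expR thB /fluctuation.
have sq : Num.sqrt ((k + l)%:R : R) ^+ 2 = (k + l)%:R by rewrite sqr_sqrtr // ltW.
have -> : theta * (B * Num.sqrt (k + l)%:R * (1 + 4 * ln (k + l)%:R)) =
    (1 + 4 * ln (k + l)%:R) / 2.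
  by rewrite /theta; field; rewrite !gt_eqF.
have : 2 * (2 * Num.sqrt ((k + l)%:R : R))^-1 ^+ 2 * l%:R <= 1 / 2.
  rewrite exprVn exprMn sq.
  have -> : 2 * (2 ^+ 2 * (k + l)%:R)^-1 * l%:R = (l%:R / (k + l)%:R) / 2 :> R.
    by field; rewrite -natrD gt_eqF.
  by rewrite div1r ger_pMl ?invr_gt0 // ler_pdivrMr // mul1r ler_nat leq_addl.
by lra.
Qed.

(** [chernoff] for the centred indicator of a letter and for its negative, at [theta = delta / 4];
    the factor [2 c] counts signs and letters. *)
Lemma sum_wprod_deviation (delta : R) (M : nat) : 0 < delta -> delta <= 2 ->
  \sum_(0 <= y < c ^ M | has (fun b =>
      delta * M%:R < `|dsum (fun d => (d == b)%:R) c M y - M%:R * P b|) (iota 0 c))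
    wprod P c M y <= 2 * c%:R * expR (- (delta ^+ 2 * M%:R / 8)).
Proof.
move=> d0 d2.
apply: le_trans (sum_has_le _ _ (fun b y =>
      delta * M%:R < `|dsum (fun d => (d == b)%:R) c M y - M%:R * P b|) _) _.
  by move=> y; exact: wprod_ge0.
rewrite -[X in iota _ X]subn0 -/(index_iota 0 c).
apply: (@le_trans _ _ (\sum_(0 <= b < c) 2 * expR (- (delta ^+ 2 * M%:R / 8)))); last first.
  by rewrite sumr_const_nat subn0 -[leLHS]mulr_natr; lra.
rewrite big_nat [leRHS]big_nat; apply: ler_sum => b /= bc.
pose f (d : nat) : R := (d == b)%:R - P b.
have Pb1 : P b <= 1 by apply: le_trans (Prho b) (ltW rho1).
have fS y : dsum f c M y = dsum (fun d => (d == b)%:R) c M y - M%:R * P b.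
  by rewrite /dsum /f big_split /= sumr_const card_ord mulNrn -[_ *+ M]mulr_natl.
have fNS y : dsum (fun d => - f d) c M y = - dsum f c M y.
  by rewrite /dsum -sumrN.
have f1 d : (d < c)%N -> `|f d| <= 1.
  move=> _; have := P0 b; rewrite ler_norml /f; case: (d == b) => /= h; lra.
have fN1 d : (d < c)%N -> `|- f d| <= 1 by rewrite normrN; exact: f1.
have f0 : \sum_(0 <= d < c) P d * f d = 0.
  under eq_bigr do rewrite /f mulrBr.
  rewrite sumrB -mulr_suml P1 mul1r big_mkord (bigD1 (Ordinal bc)) //= eqxx mulr1.
  rewrite big1 ?addr0 ?subrr // => i ib.
  have /negbTE -> : (i : nat) != b by apply: contra ib => /eqP e; apply/eqP/val_inj.
  by rewrite mulr0.
have fN0 : \sum_(0 <= d < c) P d * - f d = 0.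
  by under eq_bigr do rewrite mulrN; rewrite sumrN f0 oppr0.
have th0 : 0 <= delta / 4 by lra.
have th1 : delta / 4 * 1 <= 1 / 2 by lra.
have c1 := chernoff hc P0 P1 (delta * M%:R) M f1 f0 th0 th1.
have c2 := chernoff hc P0 P1 (delta * M%:R) M fN1 fN0 th0 th1.
have eE : 2 * (delta / 4 * 1) ^+ 2 * M%:R - delta / 4 * (delta * M%:R) =
    - (delta ^+ 2 * M%:R / 8) by field.
rewrite !eE in c1 c2.
apply: (@le_trans _ _ (expR (- (delta ^+ 2 * M%:R / 8)) + expR (- (delta ^+ 2 * M%:R / 8)))); last by lra.
apply: le_trans (lerD c1 c2).
rewrite big_mkcond [X in _ <= X + _]big_mkcond [X in _ <= _ + X]big_mkcond -big_split /=.
apply: ler_sum => y _; rewrite fNS -fS.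
have W0 := wprod_ge0 c M y P0.
case: ifP => [h|_]; last by apply: addr_ge0; case: ifP.
have [p|n] := leP 0 (dsum f c M y).
  rewrite ger0_norm // in h; rewrite (ltW h) lerDl; by case: ifP.
rewrite ltr0_norm // in h; rewrite (ltW h) lerDr; by case: ifP.
Qed.

(** The three exceptional sets have weight at most 1/8 each, [16 <= k] serving for the heavy
    prefixes, and [1 - 3/8] exceeds 1/2. *)
Lemma good_word_weight (B delta : R) (n : nat) (K : int) (M J s k : nat) :
  (n + M + s + 5 = J.*2)%N -> (n + 1 + s <= J)%N ->
  0 < B -> (forall b, (b < c)%N -> `|ln (P b) + H| <= B) ->
  (16 <= k)%N -> 0 < delta -> delta <= 2 ->
  4 * rho ^+ s / (1 - rho) <= 1 / 8 ->
  2 * c%:R * expR (- (delta ^+ 2 * M%:R / 8)) <= 1 / 8 ->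
  1 / 2 <= \sum_(0 <= y < c ^ M | good_word c P B delta n K M J s k y) wprod P c M y.
Proof.
move=> eM nJ B0 fB k16 d0 d2 hs hM.
have k0 : (0 < k)%N by apply: leq_trans k16.
have b1 := sum_wprod_heavy M k0 B0 fB.
have b2 := sum_wprod_deviation M d0 d2.
have b3 := sum_wprod_near_small_fraction hc P0 P1 Prho K rho1 eM nJ.
have k8 : 2 / k%:R <= 1 / 8 :> R.
  rewrite ler_pdivrMr ?ltr0n //.
  have : 16%:R <= k%:R :> R by rewrite ler_nat.
  by lra.
have one := sum_wprod1 hc P1 M.
rewrite /good_word; move: (iota 0 M.+1) b1 => I1 b1.
suff : \sum_(0 <= y < c ^ M) wprod P c M y <=
  \sum_(0 <= y < c ^ M | [&& all (fun l => wprod P c l (y %/ c ^ (M - l)) <=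
        expR (- (l%:R * H) + fluctuation B (k + l))) I1,
      all (fun b => `|dsum (fun d => (d == b)%:R) c M y - M%:R * P b| <= delta * M%:R)
        (iota 0 c)
    & ~~ @near_small_fraction R c n K M J (c ^ (J - s - 3)) y]) wprod P c M y +
  (2 / k%:R + 2 * c%:R * expR (- (delta ^+ 2 * M%:R / 8)) + 4 * rho ^+ s / (1 - rho)) by lra.
apply: le_trans (lerD (lexx _) (lerD (lerD b1 b2) b3)).
rewrite big_mkcond [X in _ <= X + _]big_mkcond.
rewrite [X in _ <= _ + (X + _ + _)]big_mkcond [X in _ <= _ + (_ + X + _)]big_mkcond.
rewrite [X in _ <= _ + (_ + _ + X)]big_mkcond -!big_split /=.
apply: ler_sum => y _; have W0 := wprod_ge0 c M y P0.
have -> : all (fun l => wprod P c l (y %/ c ^ (M - l)) <=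
        expR (- (l%:R * H) + fluctuation B (k + l))) I1 =
    ~~ has (fun l => expR (- (l%:R * H) + fluctuation B (k + l))
      < wprod P c l (y %/ c ^ (M - l))) I1.
  by rewrite -all_predC; apply: eq_all => l /=; rewrite leNgt.
have -> : all (fun b => `|dsum (fun d => (d == b)%:R) c M y - M%:R * P b| <= delta * M%:R)
        (iota 0 c) = ~~ has (fun b =>
      delta * M%:R < `|dsum (fun d => (d == b)%:R) c M y - M%:R * P b|) (iota 0 c).
  by rewrite -all_predC; apply: eq_all => b /=; rewrite leNgt.
by case: has; case: has; case: near_small_fraction => /=; lra.
Qed.

End GoodWordsWeight.

(** * Descent to words of a given length *)

(** The set [V_i]; strict inequality at the radius makes it open. *)
Definition freq_ball {R : realType} (c : nat) (prob : 'I_c -> R) (t : R) (i : nat) : set R :=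
  [set x | exists p : int, exists q : nat,
    [/\ (0 < q)%N && coprimez p q%:Z, (i <= q)%N,
        forall b : 'I_c, `|digit_freq c b (Num.truncn (2 * log_base c (q%:R : R)))
            (p%:~R / q%:R : R) - prob b| < i.+1%:R^-1
      & `|x - p%:~R / q%:R| < q%:R `^ (- (2 * t))]].

Section Words.
Variables (R : realType) (c : nat).
Hypothesis hc : (1 < c)%N.

Lemma word_ancestor (K : int) (M l y : nat) : (l <= M)%N ->
  ((K * (c ^ M)%:Z + y%:Z) %/ (c ^ (M - l))%:Z)%Z =
  K * (c ^ l)%:Z + (y %/ c ^ (M - l))%N%:Z.
Proof.
move=> lM; have D0 : (c ^ (M - l))%:Z != 0.
  by rewrite eqz_nat -lt0n expn_gt0 (ltn_trans _ hc).
have -> : (c ^ M)%:Z = (c ^ l)%:Z * (c ^ (M - l))%:Z.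
  by rewrite -PoszM -expnD subnKC.
by rewrite mulrA divzMDl // divz_nat.
Qed.

(** Transfers [exists_cheap_node] to words with targets [d y]. A node of generation at most [n + M]
    catches words with a common prefix, whence the condition on prefixes; a node between generations
    [n + M] and [m] meets the target of one word only, whence the pointwise conditions. *)
Lemma cheap_word (G : nat -> R) (o : nat -> option (nat * int)) (n : nat) (K : int)
    (M m : nat) (A : pred nat) (w : nat -> R) (d : nat -> int) (tau tau' : R) :
  (forall N, 0 <= G N) -> 0 < tau -> 0 < tau' -> (forall y, 0 <= w y) ->
  1 <= \sum_(0 <= y < c ^ M | A y) w y -> (n + M <= m)%N ->
  (forall y, (y < c ^ M)%N -> A y ->
     sub_node c (m, d y) ((n + M)%N, K * (c ^ M)%:Z + y%:Z)) ->
  (forall l y0, (l <= M)%N -> (y0 < c ^ M)%N -> A y0 ->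
     (\sum_(0 <= y < c ^ M | A y && (y %/ c ^ (M - l) == y0 %/ c ^ (M - l))%N) w y) * tau
       <= G (n + l)%N) ->
  (forall y, (y < c ^ M)%N -> A y -> w y * tau <= tau') ->
  (forall y N, (y < c ^ M)%N -> A y -> (n + M <= N)%N -> (N <= m)%N -> w y * tau <= G N) ->
  (forall p, ~~ covers_node c (o p) (n, K)) ->
  (node_cost c G o (n, K) < tau%:E)%E ->
  exists y, [/\ (y < c ^ M)%N, A y, forall p, ~~ covers_node c (o p) (m, d y)
    & (node_cost c G o (m, d y) < tau'%:E)%E].
Proof.
move=> G0 tau0 tau'0 w0 w1 Mm dsub dl dtau dN nocov cost.
have wsub y : sub_node c ((n + M)%N, K * (c ^ M)%:Z + y%:Z) (n, K) || (c ^ M <= y)%N.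
  have [yM|yM] := ltnP y (c ^ M); last by rewrite orbT.
  rewrite orbF /sub_node /= leq_addr /= addKn.
  have := @word_ancestor K M 0 y (leq0n _); rewrite subn0 expn0 mulr1 => ->.
  by rewrite divn_small // addr0.
have dinj0 : forall y y', (y < c ^ M)%N -> (y' < c ^ M)%N -> A y -> A y' ->
    forall z : nat * int, (n + M <= z.1)%N ->
    sub_node c (m, d y) z -> sub_node c (m, d y') z -> y = y'.
  move=> y y' yM y'M Ay Ay' z nz yz y'z.
  have /andP[_ /eqP /= e] := sub_node_common yz (dsub _ yM Ay) nz.
  have /andP[_ /eqP /= e'] := sub_node_common y'z (dsub _ y'M Ay') nz.
  by move: e'; rewrite e => /addrI [].
have dsub' (y : 'I_(c ^ M)) : A y -> sub_node c (m, d y) (n, K).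
  move=> Ay; apply: sub_node_trans (dsub _ (ltn_ord y) Ay) _.
  by have := wsub y; rewrite leqNgt ltn_ord orbF.
have dinj : {in (fun y : 'I_(c ^ M) => A y) &, injective (fun y : 'I_(c ^ M) => d y)}.
  move=> y y' Ay Ay' e; apply/val_inj.
  apply: (dinj0 _ _ (ltn_ord y) (ltn_ord y') Ay Ay' (m, d y)) => //.
    exact: sub_node_refl.
  by rewrite e sub_node_refl.
have dG z : sub_node c z (n, K) -> (z.1 <= m)%N ->
    (\sum_(y : 'I_(c ^ M) | A y && sub_node c (m, d y) z) w y) * tau <= G z.1.
  move=> zb zm.
  have [[y0 /andP[Ay0 y0z]]|none] := pselect (exists y0 : 'I_(c ^ M), A y0 && sub_node c (m, d y0) z); last first.
    rewrite big1 ?mul0r // => y /andP[Ay yz].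
    by exfalso; apply: none; exists y; rewrite Ay.
  have [zn|nz] := leqP (n + M) z.1.
    rewrite (bigD1 y0) ?Ay0 //= big1 ?addr0; first exact: dN.
    move=> y /andP[/andP[Ay yz] ne].
    have /val_inj e := dinj0 _ _ (ltn_ord y) (ltn_ord y0) Ay Ay0 z zn yz y0z.
    by rewrite e eqxx in ne.
  have nz1 : (n <= z.1)%N by case/andP: zb.
  pose l := (z.1 - n)%N.
  have lM : (l <= M)%N by rewrite leq_subLR ltnW.
  have zE : z.1 = (n + l)%N by rewrite subnKC.
  have anc (y : 'I_(c ^ M)) : A y -> sub_node c (m, d y) z ->
      K * (c ^ l)%:Z + (y %/ c ^ (M - l))%N%:Z = z.2.
    move=> Ay yz.
    have /andP[_ /eqP /=] := sub_node_common (dsub _ (ltn_ord y) Ay) yz (ltnW nz).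
    by rewrite zE subnDl word_ancestor.
  rewrite zE; apply: le_trans (dl l y0 lM (ltn_ord y0) Ay0).
  apply: ler_wpM2r; first exact: ltW.
  rewrite [leRHS]big_mkord big_mkcond [leRHS]big_mkcond.
  apply: ler_sum => y _; case: ifP => [/andP[Ay yz]|_]; last by case: ifP.
  rewrite Ay /= ifT //; have := anc _ Ay0 y0z.
  by rewrite -(anc _ Ay yz) => /addrI [->].
rewrite big_mkord in w1.
have [y Ay [h1 h2]] := @exists_cheap_node R c G o (n, K) 'I_(c ^ M)
  (fun y => A y) (fun y => w y) m (fun y => d y) tau tau' G0 tau0 tau'0
  (fun y _ => w0 y) w1 dsub' dinj dG (fun y => dtau y (ltn_ord y)) nocov cost.
by exists y; split.
Qed.

(** Equal weights [c^-k] are admissible since [G] drops by at most a factor [c] per generation. The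
    cost obtained is below [G (n + k)] by a factor that grows with [k] once [G] dominates the gauge
    with its sublinear surplus. *)
Lemma cheap_descendant (G : nat -> R) (o : nat -> option (nat * int)) (n : nat) (K : int) (k : nat) :
  (forall N, 0 < G N) ->
  (forall d, c%:R ^- d * G n <= G (n + d)%N) ->
  (forall p, ~~ covers_node c (o p) (n, K)) ->
  (node_cost c G o (n, K) < (G n)%:E)%E ->
  exists K1, [/\ sub_node c ((n + k)%N, K1) (n, K),
    forall p, ~~ covers_node c (o p) ((n + k)%N, K1)
    & (node_cost c G o ((n + k)%N, K1) < (c%:R ^- k * G n)%:E)%E].
Proof.
move=> G0 Gd nocov cost.
have c0 : 0 < c%:R :> R by rewrite ltr0n ltnW.
pose U (b : nat) : R := c%:R^-1.
have U0 b : 0 <= U b by rewrite invr_ge0 ltW.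
have U1 : \sum_(0 <= b < c) U b = 1.
  by rewrite sumr_const_nat subn0 -[LHS]mulr_natr mulVf ?gt_eqF.
have WU l y : wprod U c l y = c%:R ^- l.
  by rewrite /wprod prodr_const card_ord exprVn.
have dl l y0 : (l <= k)%N -> (y0 < c ^ k)%N -> true ->
   (\sum_(0 <= y < c ^ k | true && (y %/ c ^ (k - l) == y0 %/ c ^ (k - l))%N)
     wprod U c k y) * G n <= G (n + l)%N.
  move=> lk y0k _ /=.
  have y0l : (y0 %/ c ^ (k - l) < c ^ l)%N.
    by rewrite ltn_divLR ?expn_gt0 ?(ltnW hc) // -expnD subnKC.
  have := @sum_wprod_fiber R c hc U U1 l (k - l) _ y0l.
  by rewrite subnKC // => ->; rewrite WU.
have tau'0 : 0 < c%:R ^- k * G n by rewrite mulr_gt0 // invr_gt0 exprn_gt0.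
have w1 : 1 <= \sum_(0 <= y < c ^ k | true) wprod U c k y by rewrite sum_wprod1.
have [] := @cheap_word G o n K k (n + k) xpredT (wprod U c k)
  (fun y => K * (c ^ k)%:Z + y%:Z) (G n) (c%:R ^- k * G n)
  (fun N => ltW (G0 N)) (G0 n) tau'0 (fun y => wprod_ge0 c k y U0) w1 (leqnn _) _ dl _ _ nocov cost.
- by move=> y _ _; exact: sub_node_refl.
- by move=> y _ _; rewrite WU.
- move=> y N _ _ kN Nk; have -> : N = (n + k)%N by apply/eqP; rewrite eqn_leq Nk kN.
  by rewrite WU.
move=> y [yk _ h1 h2].
exists (K * (c ^ k)%:Z + y%:Z); split => //.
rewrite /sub_node /= leq_addr /= addKn.
have := @word_ancestor K k 0 y (leq0n _); rewrite subn0 expn0 mulr1 => ->.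
by rewrite divn_small // addr0.
Qed.

Lemma adic_digit_word (v : R) (n : nat) (K : int) (M y i : nat) :
  Num.floor (v * c%:R ^+ (n + M)) = K * (c ^ M)%:Z + y%:Z -> (i < M)%N ->
  adic_digit c v (n + M - i) = (y %/ c ^ i %% c)%N.
Proof.
move=> vE iM; rewrite /adic_digit.
have -> : Num.floor (v * c%:R ^+ (n + M - i)) = K * (c ^ (M - i))%:Z + (y %/ c ^ i)%N%:Z.
  have iM' := ltnW iM.
  rewrite -(floor_divz hc v (n + M - i) i) subnK ?(leq_trans iM') ?leq_addl // vE.
  have := @word_ancestor K M (M - i) y (leq_subr _ _).
  by rewrite subKn.
have -> : (c ^ (M - i))%:Z = (c ^ (M - i.+1))%:Z * c%:Z.
  by rewrite -PoszM -expnSr subnSK.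
by rewrite mulrA modzMDl modz_nat.
Qed.

(** The letters of [y] are the digits [n + 1] to [n + M] of [v]. The first [n] digits, and the at
    most [D] digits between [J] and [n + M], change the count by at most 1 each. *)
Lemma digit_count_word (v : R) (n : nat) (K : int) (M y J D b : nat) :
  Num.floor (v * c%:R ^+ (n + M)) = K * (c ^ M)%:Z + y%:Z ->
  (J <= n + M + D)%N -> (n + M <= J + D)%N ->
  `|#|[set p : 'I_J | digit c v p.+1 == b]%SET|%:R - dsum (fun d => (d == b)%:R) c M y| <=
    (n + D)%:R :> R.
Proof.
move=> vE JD DJ.
pose a p : R := (adic_digit c v p.+1 == b)%:R.
have a0 p : 0 <= a p by rewrite ler0n.
have a1 p : a p <= 1 by rewrite /a; case: eqP; rewrite ?ler01.
have sum0 i j : 0 <= \sum_(i <= p < j) a p by apply: sumr_ge0.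
have sum1 i j : \sum_(i <= p < j) a p <= (j - i)%:R.
  apply: (@le_trans _ _ (\sum_(i <= p < j) 1)); first exact: ler_sum.
  by rewrite sumr_const_nat.
have -> : #|[set p : 'I_J | digit c v p.+1 == b]%SET|%:R = \sum_(0 <= p < J) a p.
  rewrite -sum1_card natr_sum big_mkcond big_mkord; apply: eq_bigr => p _.
  by rewrite inE (digitE hc) /a; case: eqP.
have -> : dsum (fun d => (d == b)%:R) c M y = \sum_(n <= p < n + M) a p.
  rewrite /dsum -{1}[n]add0n big_addn addKn big_nat_rev big_mkord add0n.
  apply: eq_bigr => i _; rewrite /a -(adic_digit_word vE (ltn_ord i)).
  congr (adic_digit c v _ == b)%:R.
  by have := ltn_ord i; lia.
have e1 : \sum_(0 <= p < n + M) a p = \sum_(0 <= p < n) a p + \sum_(n <= p < n + M) a p.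
  by rewrite (@big_cat_nat _ _ _ n) ?leq_addr.
have s0 := sum0 0 n; have s1 := sum1 0 n; rewrite subn0 in s1.
have [h|h] := leqP J (n + M).
  have e2 : \sum_(0 <= p < n + M) a p = \sum_(0 <= p < J) a p + \sum_(J <= p < n + M) a p.
    by rewrite (@big_cat_nat _ _ _ J).
  have s2 := sum0 J (n + M); have s3 := sum1 J (n + M).
  have s4 : (n + M - J)%:R <= D%:R :> R by rewrite ler_nat leq_subLR.
  have n0 : 0 <= n%:R :> R by rewrite ler0n.
  by rewrite ler_norml natrD; apply/andP; split; lra.
have e2 : \sum_(0 <= p < J) a p = \sum_(0 <= p < n + M) a p + \sum_(n + M <= p < J) a p.
  by rewrite (@big_cat_nat _ _ _ (n + M)) // ltnW.
have s2 := sum0 (n + M) J; have s3 := sum1 (n + M) J.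
have s4 : (J - (n + M))%:R <= D%:R :> R by rewrite ler_nat leq_subLR.
have D0 : 0 <= D%:R :> R by rewrite ler0n.
have n0 : 0 <= n%:R :> R by rewrite ler0n.
by rewrite ler_norml natrD; apply/andP; split; lra.
Qed.

End Words.

(** * Target intervals and their gauge *)

Definition digit_wt {R : realType} (c : nat) (prob : 'I_c -> R) (b : nat) : R :=
  if insub b is Some i then prob i else 0.

Section Targets.
Variables (R : realType) (c : nat).
Hypothesis hc : (1 < c)%N.

Lemma digit_wtE (prob : 'I_c -> R) (b : 'I_c) : digit_wt prob b = prob b.
Proof. by rewrite /digit_wt valK. Qed.

Lemma ln_base_gt0 : 0 < ln (c%:R : R).
Proof. by rewrite ln_gt0 // ltr1n. Qed.

(** Fixes the target generation: a node of this length that contains [p/q] lies in the ball of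
    radius [q^(-2t)] around [p/q]. *)
Lemma powR_base_lt (q J : nat) (t : R) : 0 <= t -> (0 < q)%N -> (q <= c ^ J)%N ->
  c%:R ^- (Num.truncn (2 * J%:R * t)).+1 <= q%:R `^ (- (2 * t)).
Proof.
move=> t0 q0 qJ; set m := (Num.truncn _).+1.
have c0 : 0 < c%:R :> R by rewrite ltr0n ltnW.
have t20 : 0 <= 2 * t by rewrite mulr_ge0.
rewrite powRN lef_pV2 ?posrE ?exprn_gt0 ?powR_gt0 ?ltr0n ?(ltnW hc) //.
apply: (@le_trans _ _ ((c%:R ^+ J) `^ (2 * t))).
  by apply: ge0_ler_powR; rewrite ?nnegrE ?exprn_ge0 ?ler0n // -natrX ler_nat.
rewrite -[c%:R ^+ J]powR_mulrn ?(ltW c0) // -powRrM -powR_mulrn ?(ltW c0) //.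
apply: ler_powR; first by rewrite ler1n ltnW.
have /andP[_ h] : (Num.truncn (2 * J%:R * t))%:R <= 2 * J%:R * t < m%:R.
  by apply: truncn_itv; rewrite !mulr_ge0.
by apply: ltW; apply: le_lt_trans h; rewrite mulrCA mulrA.
Qed.

Lemma truncn_log_base (q a b : nat) : (c ^ a <= q)%N -> (q <= c ^ b)%N ->
  (a.*2 <= Num.truncn (2 * log_base c (q%:R : R)) <= b.*2)%N.
Proof.
move=> aq qb; have L0 := ln_base_gt0.
have q0 : (0 < q)%N by rewrite (leq_trans _ aq) // expn_gt0 ltnW.
have q0' : 0 < q%:R :> R by rewrite ltr0n.
have c0 : 0 < c%:R :> R by rewrite ltr0n ltnW.
have lnX n : ln ((c ^ n)%:R : R) = n%:R * ln c%:R by rewrite natrX lnXn // mulr_natl.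
have cX0 n : 0 < (c ^ n)%:R :> R by rewrite natrX exprn_gt0.
have h1 : a%:R <= log_base c (q%:R : R).
  by rewrite /log_base ler_pdivlMr // -lnX ler_ln ?posrE // ler_nat.
have h2 : log_base c (q%:R : R) <= b%:R.
  by rewrite /log_base ler_pdivrMr // -lnX ler_ln ?posrE // ler_nat.
have x0 : 0 <= 2 * log_base c (q%:R : R) by rewrite mulr_ge0 // (le_trans _ h1).
have /andP[t1 t2] := truncn_itv x0.
have e n : n.*2%:R = 2 * n%:R :> R by rewrite -mul2n natrM.
apply/andP; split.
  by rewrite -ltnS -(ltr_nat R) e; apply: le_lt_trans t2; rewrite ler_pM2l.
by rewrite -(ler_nat R) e; apply: (le_trans t1); rewrite ler_pM2l.
Qed.

(** [dirichlet] at the word center with [Q = c^J] gives [p/q] with [q >= c^(J-s-3)], the word being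
    good, so [p/q] is within a quarter of the interval length of the center. It thus has the digits
    of the word, and its node of generation [m] is the target. The strict inequality between right
    end points serves [nested_nodes_point]. *)
Lemma word_target (prob : 'I_c -> R) (t B delta : R) (i n : nat) (K : int)
    (M J s k y : nat) :
  1 <= t -> (forall b, 0 <= prob b <= 1) ->
  (n + M + s + 5 = J.*2)%N -> (i + s + 3 <= J)%N ->
  delta = (4 * i.+1%:R)^-1 ->
  2 * (n + s + 5)%:R + 2 * delta * s.+1%:R <= delta * M%:R ->
  good_word c (digit_wt prob) B delta n K M J s k y ->
  let m := (Num.truncn (2 * J%:R * t)).+1 in
  exists K', [/\ sub_node c (m, K') ((n + M)%N, K * (c ^ M)%:Z + y%:Z),
    (K' + 1)%:~R / c%:R ^+ m < (K * (c ^ M)%:Z + y%:Z + 1)%:~R / c%:R ^+ (n + M) :> R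
    & forall x : R, Num.floor (x * c%:R ^+ m) = K' -> freq_ball prob t i x].
Proof.
move=> t1 prob01 eM iJ dE HM /and3P[_ /allP dev nsf] m.
have cX a : 0 < c%:R ^+ a :> R by apply: baseX_gt0.
have c2 : 2 <= c%:R :> R by rewrite (ler_nat R 2).
have c1 : 1 <= c%:R :> R by rewrite ler1n ltnW.
have cJ0 : (0 < c ^ J)%N by rewrite expn_gt0 ltnW.
have [p [q [/andP[q0 qQ] cop close]]] := dirichlet (word_center c n K M y : R) cJ0.
rewrite natrX in close.
have qlow : (c ^ (J - s - 3) <= q)%N.
  rewrite leqNgt; apply/negP => qlt; move/negP: nsf; apply.
  by apply/asboolP; exists p, q.
pose v : R := p%:~R / q%:R; rewrite -/v in close.
pose w := K * (c ^ M)%:Z + y%:Z; pose j := (n + M)%N.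
have close2 : `|word_center c n K M y - v| * c%:R ^+ j <= 1 / 4.
  apply: (@le_trans _ _ ((c%:R ^+ (j + 2))^-1 * c%:R ^+ j)).
    apply: ler_wpM2r; first exact: ltW.
    apply: (le_trans close); rewrite lef_pV2 ?posrE ?mulr_gt0 ?ltr0n //.
    have -> : (j + 2 = (J - s - 3) + J)%N by rewrite /j; clear -eM iJ; lia.
    by rewrite exprD ler_wpM2r ?(ltW (cX _)) // -natrX ler_nat.
  rewrite exprD invfM mulrC mulrA divff ?gt_eqF // !mul1r lef_pV2 ?posrE //.
  have : 2 * 2 <= c%:R * c%:R :> R by rewrite ler_pM.
  by rewrite expr2; lra.
have vlo : w%:~R + 1 / 4 <= v * c%:R ^+ j <= w%:~R + 3 / 4.
  have e : (word_center c n K M y - v) * c%:R ^+ j = w%:~R + 1 / 2 - v * c%:R ^+ j.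
    by rewrite mulrBl /word_center -/j divfK ?gt_eqF.
  move: close2; rewrite -[X in _ * X]gtr0_norm // -normrM e ler_norml => /andP[h1 h2].
  by apply/andP; split; lra.
have floor_j : Num.floor (v * c%:R ^+ j) = w.
  by apply: floor_def; rewrite intrD; case/andP: vlo => h1 h2; apply/andP; split; lra.
have jm : (j + 3 <= m)%N.
  apply: ltnW; rewrite -(ltr_nat R).
  have /andP[_ h] : (Num.truncn (2 * J%:R * t))%:R <= 2 * J%:R * t < m%:R.
    by apply: truncn_itv; rewrite !mulr_ge0 // (le_trans ler01).
  apply: le_lt_trans h; apply: (@le_trans _ _ (2 * J%:R)); last by rewrite ler_peMr.
  by rewrite -[2 * _]natrM ler_nat /j; clear -eM; lia.
have jm' : (j <= m)%N by apply: leq_trans jm; rewrite leq_addr.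
exists (Num.floor (v * c%:R ^+ m)).
have /andP[f1 f2] := floor_itv (v * c%:R ^+ m).
split.
- rewrite /sub_node /= -/j jm' /=.
  have := floor_divz hc v j (m - j); rewrite subnKC // => ->.
  by rewrite floor_j.
(* The target is at most 1/8 as long as the word interval and starts at most 3/4 along it, so its
   right end point stays strictly inside. *)
- have X8 : 8 <= c%:R ^+ (m - j) :> R.
    apply: (@le_trans _ _ (c%:R ^+ 3)); last by rewrite ler_weXn2l // leq_subRL.
    apply: (@le_trans _ _ (2 ^+ 3)); first by rewrite !exprS expr0; lra.
    by apply: lerXn2r; rewrite ?nnegrE.
  have mE : c%:R ^+ m = c%:R ^+ (m - j) * c%:R ^+ j :> R by rewrite -exprD subnK.
  set F := Num.floor _ in f1 f2 *.
  have -> : (F + 1)%:~R = F%:~R + 1 :> R by rewrite intrD.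
  rewrite -/w -/j; have -> : (w + 1)%:~R = w%:~R + 1 :> R by rewrite intrD.
  rewrite ltr_pdivrMr //; apply: (@lt_le_trans _ _ ((w%:~R + 1) * c%:R ^+ (m - j))); last first.
    by rewrite mE mulrA mulrAC divfK ?gt_eqF.
  case/andP: vlo => h1 h2.
  rewrite mE mulrA mulrAC in f1.
  have : v * c%:R ^+ j * c%:R ^+ (m - j) <= (w%:~R + 3 / 4) * c%:R ^+ (m - j).
    by rewrite ler_wpM2r // (le_trans _ X8).
  rewrite !mulrDl mul1r => h3.
  by lra.
move=> x xE; exists p, q; split => //.
- by rewrite q0 cop.
- apply: leq_trans qlow; apply: ltnW; apply: leq_ltn_trans (ltn_expl _ hc).
  by clear -iJ; lia.
(* The frequency runs over [J'] digits with [2 (J - s - 3) <= J' <= 2 J], where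
   [2 J = n + M + s + 5]. Thus [J'] and [M] differ by at most [n + s + 5], which [HM] makes small
   against [delta * M]. *)
- move=> b; rewrite -/v /digit_freq.
  have /andP[J1 J2] := truncn_log_base qlow qQ.
  set J' := Num.truncn _ in J1 J2 *.
  have JD : (J' <= n + M + (s + 5))%N by clear -eM iJ J1 J2; lia.
  have DJ : (n + M <= J' + (s + 5))%N by clear -eM iJ J1 J2; lia.
  have cnt := @digit_count_word R c hc v n K M y J' (s + 5) b floor_j JD DJ.
  set N : R := #|_|%:R in cnt *.
  have := dev b; rewrite mem_iota /= add0n ltn_ord => /(_ isT).
  rewrite digit_wtE => devb.
  have JM : J'%:R <= M%:R + (n + s + 5)%:R :> R by rewrite -natrD ler_nat; clear -eM iJ J1 J2; lia.
  have MJ : M%:R <= J'%:R + (n + s + 5)%:R :> R by rewrite -natrD ler_nat; clear -eM iJ J1 J2; lia.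
  have MJ2 : M%:R <= J'%:R + s.+1%:R :> R by rewrite -natrD ler_nat; clear -eM iJ J1 J2; lia.
  have d0 : 0 < delta by rewrite dE invr_gt0 mulr_gt0.
  have -> : i.+1%:R^-1 = 4 * delta by rewrite dE invfM mulrA mulfV ?mul1r.
  rewrite addnA in cnt.
  set E : R := (n + s + 5)%:R in HM cnt JM MJ *.
  have E0 : 0 < E by rewrite ltr0n addnS.
  have M2 : delta * M%:R <= delta * J'%:R + delta * s.+1%:R by rewrite -mulrDr ler_pM2l.
  have ds0 : 0 <= delta * s.+1%:R by rewrite mulr_ge0 // ltW.
  have J0 : 0 < J'%:R :> R.
    have : 0 < delta * J'%:R by lra.
    by rewrite pmulr_rgt0.
  have [p0 p1] : 0 <= prob b /\ prob b <= 1 by apply/andP.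
  have MJp : `|M%:R * prob b - J'%:R * prob b| <= E.
    rewrite -mulrBl normrM [`|prob b|]ger0_norm //.
    apply: (@le_trans _ _ (`|M%:R - J'%:R| * 1)); first by rewrite ler_wpM2l.
    by rewrite mulr1 ler_norml; apply/andP; split; lra.
  have -> : N / J'%:R - prob b = (N - J'%:R * prob b) / J'%:R.
    by field; rewrite gt_eqF.
  rewrite normrM [`|J'%:R^-1|]gtr0_norm ?invr_gt0 // ltr_pdivrMr //.
  set S := dsum _ _ _ _ in cnt devb.
  have tri1 := ler_distD S N (J'%:R * prob b).
  have tri2 := ler_distD (M%:R * prob b) S (J'%:R * prob b).
  have fin (x1 x2 x3 x4 x5 dM dJ ds : R) : x1 <= x2 + x3 -> x3 <= x4 + x5 -> x2 <= E ->
    x4 <= dM -> x5 <= E -> dM <= dJ + ds -> 2 * E + 2 * ds <= dM -> 0 <= ds -> x1 < 4 * dJ by lra.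
  have HM' : 2 * E + 2 * (delta * s.+1%:R) <= delta * M%:R by rewrite [2 * (_ * _)]mulrA.
  by rewrite -mulrA; exact: fin tri1 tri2 cnt devb MJp M2 HM' ds0.
- rewrite -/v; apply: lt_le_trans (powR_base_lt (le_trans ler01 t1) q0 qQ).
  have /andP[g1 g2] := floor_itv (x * c%:R ^+ m).
  rewrite -/m -[c%:R ^- m]mul1r ltr_pdivlMr //.
  rewrite -[X in _ * X]gtr0_norm // -normrM mulrBl ltr_norml.
  rewrite xE in g1 g2; rewrite intrD in f2 g2.
  by apply/andP; split; lra.
Qed.

(** On the logarithmic scale, the bound on [N] makes the main term of the gauge at most
    [(n+s+6+k+l) H]. Here [l H] cancels against the weight, [k H] is paid by [c^-k] because
    [H <= ln c], and the rest, with [ln 2 + ln g] and the fluctuation, is absorbed by the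
    surplus. *)
Lemma weight_le_gauge (H t gamma B g : R) (G : nat -> R) (n s k l N N1 k0 : nat) :
  1 <= t -> 0 <= H -> H <= ln c%:R -> 0 < g -> 0 <= gamma ->
  (forall N, (N1 <= N)%N ->
    expR (- (H / ln c%:R / t * (N%:R * ln c%:R)) + 3 * (N%:R * ln c%:R) `^ gamma) <= G N) ->
  (forall x : nat, (k0 <= x)%N ->
    (ln 2 + ln g + (n + s + 6)%:R * ln c%:R) + B * Num.sqrt x%:R * (1 + 4 * ln x%:R) <=
      3 * (x%:R * ln c%:R) `^ gamma) ->
  (k0 <= k)%N -> (N1 <= N)%N -> (k + l <= N)%N ->
  N%:R <= t * (n + s + 6 + k + l)%:R ->
  2 * expR (- (l%:R * H) + fluctuation B (k + l)) * (c%:R ^- k * g) <= G N.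
Proof.
move=> t1 H0 HL g0 ga0 hG hk k0k N1N klN Nt.
have L0 := ln_base_gt0; set L := ln c%:R in L0 HL hG hk *.
have t0 : 0 < t by apply: lt_le_trans t1.
have c0 : 0 < c%:R :> R by rewrite ltr0n ltnW.
apply: le_trans (hG N N1N).
have -> : 2 * expR (- (l%:R * H) + fluctuation B (k + l)) * (c%:R ^- k * g) =
   expR (ln 2 + ln g - k%:R * L - l%:R * H + fluctuation B (k + l)).
  have -> : c%:R ^- k = expR (- (k%:R * L)).
    by rewrite expRN expRM_natl lnK.
  rewrite -{1}[2]lnK ?posrE // -{1}[g]lnK ?posrE // -!expRD.
  by congr expR; ring.
rewrite ler_expR.
have h1 := hk (k + l)%N (leq_trans k0k (leq_addr _ _)).
have h2 : ((k + l)%:R * L) `^ gamma <= (N%:R * L) `^ gamma.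
  apply: ge0_ler_powR; rewrite ?nnegrE ?mulr_ge0 ?(ltW L0) ?ler0n //.
  by rewrite ler_pM2r // ler_nat.
have h3 : H / L / t * (N%:R * L) <= (n + s + 6 + k + l)%:R * H.
  have -> : H / L / t * (N%:R * L) = N%:R / t * H by field; rewrite !gt_eqF.
  by rewrite ler_wpM2r // ler_pdivrMr // mulrC.
have h4 : (n + s + 6 + k)%:R * H <= (n + s + 6 + k)%:R * L by rewrite ler_wpM2l.
rewrite -/(fluctuation B (k + l)) in h1.
rewrite [(n + s + 6 + k + l)%:R]natrD mulrDl in h3.
rewrite [X in _ <= X * _]natrD [leRHS]mulrDl in h4.
have fin (x1 x2 x3 x4 y1 y2 y3 z1 z2 f : R) : (x1 + x2 + x3) + f <= y1 -> y1 <= y2 ->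
  z1 <= z2 + x4 -> z2 <= x3 + y3 -> x1 + x2 - y3 - x4 + f <= - z1 + y2 by lra.
have {}h2 := ler_wpM2l (ler0n R 3) h2.
exact: fin h1 h2 h3 h4.
Qed.

Lemma nat_entropy_bounds (P : nat -> R) : (forall b, 0 <= P b <= 1) ->
  (forall b, (b < c)%N -> 0 < P b) -> \sum_(0 <= b < c) P b = 1 ->
  0 <= nat_entropy c P <= ln c%:R.
Proof.
move=> P01 Ppos P1; have c0 : 0 < c%:R :> R by rewrite ltr0n ltnW.
rewrite /nat_entropy -sumrN; apply/andP; split.
  apply: sumr_ge0 => b _; rewrite -mulrN mulr_ge0 ?oppr_ge0 ?ln_le0 //; by case/andP: (P01 b).
have -> : ln c%:R = \sum_(0 <= b < c) P b * ln c%:R :> R by rewrite -mulr_suml P1 mul1r.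
(* Gibbs: [ln u <= u - 1] at [u = 1 / (c P b)], averaged over [b]. *)
rewrite -subr_le0 -sumrB.
apply: (@le_trans _ _ (\sum_(0 <= b < c) (c%:R^-1 - P b))); last first.
  by rewrite sumrB P1 sumr_const_nat subn0 -[_ *+ c]mulr_natr mulVf ?gt_eqF // subrr.
rewrite big_nat [leRHS]big_nat; apply: ler_sum => b /= bc.
have p0 := Ppos b bc.
have u0 : 0 < (c%:R * P b)^-1 by rewrite invr_gt0 mulr_gt0.
have h : ln (c%:R * P b)^-1 <= (c%:R * P b)^-1 - 1.
  have e : 1 + ((c%:R * P b)^-1 - 1) = (c%:R * P b)^-1 by ring.
  by rewrite -{1}e; apply: le_ln1Dx; lra.
rewrite lnV ?posrE ?mulr_gt0 // lnM ?posrE // -(ler_pM2l p0) invfM in h.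
have e : P b * (c%:R^-1 / P b - 1) = c%:R^-1 - P b by field; rewrite !gt_eqF.
rewrite e in h; lra.
Qed.

End Targets.

(** * One refinement step *)

Section Refine.
Variables (R : realType) (c : nat).
Hypothesis hc : (1 < c)%N.

Lemma sub_node_bounds (m n : nat) (K' K : int) : sub_node c (m, K') (n, K) ->
  K%:~R / c%:R ^+ n <= K'%:~R / c%:R ^+ m :> R /\
  (K' + 1)%:~R / c%:R ^+ m <= (K + 1)%:~R / c%:R ^+ n :> R.
Proof.
move=> /andP[/= nm /eqP KE].
have cX a : 0 < c%:R ^+ a :> R by apply: baseX_gt0.
have D0 : 0 < (c ^ (m - n))%:Z by rewrite ltz_nat expn_gt0 ltnW.
have e := divz_eq K' (c ^ (m - n))%:Z.
have h1 := modz_ge0 K' (lt0r_neq0 D0); have h2 := ltz_pmod K' D0.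
rewrite KE in e.
have l1 : K * (c ^ (m - n))%:Z <= K' by rewrite e lerDl.
have l2 : K' + 1 <= (K + 1) * (c ^ (m - n))%:Z.
  by rewrite mulrDl mul1r [X in X + 1 <= _]e -addrA lerD2l lezD1.
have dE : ((c ^ (m - n))%:Z)%:~R = c%:R ^+ (m - n) :> R by rewrite -natrX.
move: l1 l2; rewrite -!(ler_int R) ![(_ * (c ^ (m - n))%:Z)%:~R]intrM dE => l1 l2.
have mE : c%:R ^+ m = c%:R ^+ n * c%:R ^+ (m - n) :> R by rewrite -exprD subnKC.
split.
  by rewrite ler_pdivrMr // mulrAC ler_pdivlMr // mE [c%:R ^+ n * _]mulrC mulrA ler_wpM2r // ltW.
by rewrite ler_pdivrMr // mulrAC ler_pdivlMr // mE [c%:R ^+ n * _]mulrC mulrA ler_wpM2r // ltW.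
Qed.

Lemma le_truncn_double (J : nat) (t : R) : 1 <= t -> (J.*2 <= Num.truncn (2 * J%:R * t))%N.
Proof.
move=> t1; rewrite -ltnS -(ltr_nat R).
have /andP[_ h] : (Num.truncn (2 * J%:R * t))%:R <= 2 * J%:R * t < (Num.truncn (2 * J%:R * t)).+1%:R.
  by apply: truncn_itv; rewrite !mulr_ge0 // (le_trans ler01).
by apply: le_lt_trans h; rewrite -mul2n natrM ler_peMr.
Qed.

Lemma large_word_length (delta E : R) : 0 < delta ->
  exists M0, forall M, (M0 <= M)%N -> E <= delta * M%:R /\
    2 * c%:R * expR (- (delta ^+ 2 * M%:R / 8)) <= 1 / 8.
Proof.
move=> d0; have d20 : 0 < delta ^+ 2 by rewrite exprn_gt0.
have c0 : 0 <= c%:R :> R by rewrite ler0n.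
pose X := `|E| / delta + 128 * c%:R / delta ^+ 2.
have X1 : 0 <= `|E| / delta by rewrite divr_ge0 // ltW.
have X2 : 0 <= 128 * c%:R / delta ^+ 2 by rewrite divr_ge0 ?mulr_ge0 // ltW.
have X0 : 0 <= X by rewrite addr_ge0.
exists (Num.truncn X).+1 => M XM.
have /andP[_ XM'] := truncn_itv X0.
have {XM XM'} XM : X <= M%:R by apply: (le_trans (ltW XM')); rewrite ler_nat.
have h1 : `|E| / delta <= M%:R by rewrite /X in XM; lra.
have h2 : 128 * c%:R / delta ^+ 2 <= M%:R by rewrite /X in XM; lra.
rewrite ler_pdivrMr // in h1; rewrite ler_pdivrMr // in h2.
split; first by rewrite (le_trans (ler_norm _)) // mulrC.
set z := delta ^+ 2 * M%:R / 8.
have z16 : 16 * c%:R <= z by rewrite /z; lra.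
have c16 : 0 <= 16 * c%:R :> R by rewrite mulr_ge0.
have z0 : 0 < 1 + z by lra.
rewrite expRN ler_pdivrMr ?expR_gt0 //.
have : 1 + z <= expR z by exact: expR_ge1Dx.
by lra.
Qed.

Variables (prob : 'I_c -> R) (t eta : R).
Hypothesis t1 : 1 <= t.
Hypothesis prob01 : forall b, 0 < prob b < 1.
Hypothesis prob_sum : \sum_(b < c) prob b = 1.
Hypothesis eta01 : 0 < eta < 1 / 8.

Local Notation P := (digit_wt prob).
Local Notation H := (nat_entropy c P).

Lemma digit_wt_bounds : exists2 rho : R, 0 <= rho < 1 & forall b, 0 <= P b <= rho.
Proof.
pose rho := \big[Order.max/0]_(b < c) prob b.
exists rho.
  apply/andP; split; first by apply: bigmax_ge_id.
  by apply/bigmax_ltP; split=> // b _; case/andP: (prob01 b).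
move=> b; rewrite /digit_wt; case: insubP => [i _ _|_].
  by have /andP[/ltW -> _] := prob01 i; rewrite /= le_bigmax.
by rewrite lexx /=; apply: bigmax_ge_id.
Qed.

Lemma digit_wt_gt0 (b : nat) : (b < c)%N -> 0 < P b.
Proof.
by move=> bc; rewrite -[b]/(val (Ordinal bc)) digit_wtE; case/andP: (prob01 (Ordinal bc)).
Qed.

Lemma digit_wt_sum : \sum_(0 <= b < c) P b = 1.
Proof. by rewrite big_mkord -[RHS]prob_sum; apply: eq_bigr => b _; rewrite digit_wtE. Qed.

Lemma entropyE : entropy prob = H / ln c%:R.
Proof.
rewrite /entropy /nat_entropy big_mkord mulNr mulr_suml; congr (- _).
by apply: eq_bigr => b _; rewrite digit_wtE /log_base mulrA.
Qed.

(** The parameters are chosen in this order: [s] from [rho], then [k] from [G n] and [s], [delta]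
    from [i], and finally [J], [M] and the target generation [m] from all of these. *)
Lemma refine_node (G : nat -> R) (o : nat -> option (nat * int)) (n : nat) (K : int) (i : nat) :
  (forall N, 0 < G N) ->
  (forall N N', (n <= N)%N -> (N <= N')%N -> G N' <= G N) ->
  (forall d, c%:R ^- d * G n <= G (n + d)%N) ->
  (exists N1, forall N, (N1 <= N)%N ->
    expR (- (entropy prob / t * (N%:R * ln c%:R)) + 3 * (N%:R * ln c%:R) `^ (eta + 7 / 8)) <= G N) ->
  (forall p, ~~ covers_node c (o p) (n, K)) ->
  (node_cost c G o (n, K) < (G n)%:E)%E ->
  exists m K', [/\ (n < m)%N, sub_node c (m, K') (n, K),
    (K' + 1)%:~R / c%:R ^+ m < (K + 1)%:~R / c%:R ^+ n :> R,
    forall x : R, Num.floor (x * c%:R ^+ m) = K' -> freq_ball prob t i x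
    & (forall p, ~~ covers_node c (o p) (m, K')) /\
      (node_cost c G o (m, K') < (G m)%:E)%E].
Proof.
move=> G0 Gmono Gd [N1 hG] nocov cost.
have cX a : 0 < c%:R ^+ a :> R by apply: baseX_gt0.
have [rho /andP[rho0 rho1] Prho] := digit_wt_bounds.
have P0 b : 0 <= P b by case/andP: (Prho b).
have Ple b : P b <= rho by case/andP: (Prho b).
have Pge0_le1 b : 0 <= P b <= 1 by rewrite P0 (le_trans (Ple b)) // ltW.
have prob_le b : 0 <= prob b <= 1 by case/andP: (prob01 b) => /ltW -> /ltW ->.
have /andP[H0 HL] := nat_entropy_bounds hc Pge0_le1 digit_wt_gt0 digit_wt_sum.
pose B : R := 1 + \sum_(0 <= b < c) `|ln (P b) + H|.
have S0 : 0 <= \sum_(0 <= b < c) `|ln (P b) + H| by apply: sumr_ge0.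
have B0 : 0 < B by rewrite /B; lra.
have fB b : (b < c)%N -> `|ln (P b) + H| <= B.
  move=> bc; rewrite /B big_mkord (bigD1 (Ordinal bc)) //=.
  have : 0 <= \sum_(j < c | j != Ordinal bc) `|ln (P j) + H| by apply: sumr_ge0.
  by lra.
have [s hs] : exists s, 4 * rho ^+ s / (1 - rho) <= 1 / 8.
  have r1 : `|rho| < 1 by rewrite ger0_norm.
  have e0 : 0 < (1 - rho) / 32 by rewrite divr_gt0 // subr_gt0.
  have [s _ hs] := cvgr_lt _ (cvg_expr r1) _ e0.
  exists s; have := hs s (leqnn s) => /= h.
  by rewrite ler_pdivrMr ?subr_gt0 //; lra.
pose gamma := eta + 7 / 8.
have /andP[eta0 _] := eta01.
have ga : 3 / 4 < gamma by rewrite /gamma; lra.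
have L0 := ln_base_gt0 R hc.
have [k0 _ hk] := sqrt_ln_le_powR (ln 2 + ln (G n) + (n + s + 6)%:R * ln c%:R) (ltW B0) L0 ga.
(* [k0] makes the surplus of the gauge sufficient, [N1] brings the later generations into the range
   of [hG], and 16 is for [good_word_weight]. *)
pose k := (k0 + N1 + 16)%N.
have k0k : (k0 <= k)%N by rewrite /k -addnA leq_addr.
have N1k : (N1 <= k)%N by rewrite /k addnAC leq_addl.
have k16 : (16 <= k)%N by rewrite leq_addl.
have [K1 [sub1 nocov1 cost1]] := cheap_descendant hc k G0 Gd nocov cost.
pose n' := (n + k)%N.
pose delta : R := (4 * i.+1%:R)^-1.
have d0 : 0 < delta by rewrite invr_gt0 mulr_gt0.
have d2 : delta <= 2.
  apply: (@le_trans _ _ 4^-1); last by lra.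
  by rewrite /delta lef_pV2 ?posrE ?mulr_gt0 // ler_peMr // ler1n.
have [M0 hM0] := large_word_length (2 * (n' + s + 5)%:R + 2 * delta * s.+1%:R) d0.
(* Large enough for [M0 <= M], [nJ] and [iJ]; then [M] is solved from [n' + M + s + 5 = 2 J]. *)
pose J := (M0 + n' + s + 5 + i)%N.
pose M := (J.*2 - (s + 5) - n')%N.
have eM : (n' + M + s + 5 = J.*2)%N by rewrite /M /J; clear; lia.
have M0M : (M0 <= M)%N by rewrite /M /J; clear; lia.
have nJ : (n' + 1 + s <= J)%N by rewrite /J; clear; lia.
have iJ : (i + s + 3 <= J)%N by rewrite /J; clear; lia.
have [HM1 HM2] := hM0 M M0M.
have half := good_word_weight hc P0 digit_wt_gt0 digit_wt_sum Ple rho1 K1 eM nJ B0 fB k16 d0 d2 hs HM2.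
pose m := (Num.truncn (2 * J%:R * t)).+1.
have Jm : (J.*2 < m)%N by rewrite /m ltnS le_truncn_double.
have jm : (n' + M <= m)%N by rewrite ltnW // (leq_ltn_trans _ Jm) // -eM -addnA leq_addr.
pose A := good_word c P B delta n' K1 M J s k.
have ex y : exists K', A y -> [/\ sub_node c (m, K') ((n' + M)%N, K1 * (c ^ M)%:Z + y%:Z),
    (K' + 1)%:~R / c%:R ^+ m < (K1 * (c ^ M)%:Z + y%:Z + 1)%:~R / c%:R ^+ (n' + M) :> R
    & forall x : R, Num.floor (x * c%:R ^+ m) = K' -> freq_ball prob t i x].
  have [Ay|nAy] := boolP (A y); last by exists 0.
  by have [K' h] := word_target hc t1 prob_le eM iJ erefl HM1 Ay; exists K'.
have [d hd] := choice ex.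
(* The factor 2 renormalizes the weights, as the good words carry at least half of the mass. *)
have wg l N : (N1 <= N)%N -> (k + l <= N)%N -> N%:R <= t * (n + s + 6 + k + l)%:R ->
    2 * expR (- (l%:R * H) + fluctuation B (k + l)) * (c%:R ^- k * G n) <= G N.
  move=> h1 h2 h3.
  apply: (@weight_le_gauge R c hc H t gamma B (G n) G n s k l N N1 k0) => //.
    by rewrite /gamma; lra.
  by move=> N' N'1; rewrite -entropyE; exact: hG.
have heavy l y : (l <= M)%N -> A y ->
    wprod P c l (y %/ c ^ (M - l)) <= expR (- (l%:R * H) + fluctuation B (k + l)).
  move=> lM /and3P[/allP h _ _]; apply: h.
  by rewrite mem_iota /= add0n ltnS.
pose tau := c%:R ^- k * G n.
have tau0 : 0 < tau by rewrite mulr_gt0 // invr_gt0.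
have wm y : A y -> 2 * wprod P c M y * tau <= G m.
  move=> Ay; apply: le_trans (wg M m _ _ _).
  - apply: ler_wpM2r; first exact: ltW.
    rewrite ler_pM2l //; have := heavy M y (leqnn _) Ay.
    by rewrite subnn expn0 divn1.
  - by rewrite (leq_trans N1k) // (leq_trans _ jm) // /n' -addnA addnCA leq_addr.
  - by rewrite (leq_trans _ jm) // /n' -addnA leq_addl.
  - have t0 : 0 <= t by rewrite (le_trans ler01).
    have /andP[h _] : (Num.truncn (2 * J%:R * t))%:R <= 2 * J%:R * t < m%:R.
      by apply: truncn_itv; rewrite !mulr_ge0.
    (* [m <= 2 J t + 1 <= t (2 J + 1)] since [t >= 1]; the extra 1 turns [s + 5] into [s + 6]. *)
    have -> : (n + s + 6 + k + M = J.*2 + 1)%N by rewrite -eM /n'; clear; lia.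
    rewrite /m -natr1 natrD -mul2n natrM mulrDr mulr1; apply: lerD => //.
    by rewrite [leRHS]mulrC.
have [] := @cheap_word R c hc G o n' K1 M m A
  (fun y => 2 * wprod P c M y) d tau (G m) (fun N => ltW (G0 N)) tau0 (G0 m)
  (fun y => mulr_ge0 (ler0n R 2) (wprod_ge0 c M y P0)) _ jm
  (fun y yM Ay => let: And3 h _ _ := hd y Ay in h) _ (fun y _ Ay => wm y Ay) _ nocov1 cost1.
- rewrite -mulr_sumr; move: half; rewrite -/A; lra.
- move=> l y0 lM y0M Ay0.
  apply: le_trans (wg l (n' + l)%N _ _ _).
  + apply: ler_wpM2r; first exact: ltW.
    rewrite -mulr_sumr ler_pM2l //; apply: le_trans (heavy l y0 lM Ay0).
    have y0l : (y0 %/ c ^ (M - l) < c ^ l)%N.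
      by rewrite ltn_divLR ?expn_gt0 ?(ltnW hc) // -expnD subnKC.
    have := @sum_wprod_fiber R c hc P digit_wt_sum l (M - l) _ y0l.
    rewrite subnKC // => <-.
    rewrite big_mkcond [leRHS]big_mkcond; apply: ler_sum => y _.
    by case: (A y) => //=; case: ifP => // _; exact: wprod_ge0.
  + by rewrite (leq_trans N1k) // /n' -addnA addnCA leq_addr.
  + by rewrite /n' -addnA leq_addl.
  + apply: (@le_trans _ _ (1 * (n + s + 6 + k + l)%:R)).
      by rewrite mul1r ler_nat /n'; clear; lia.
    by rewrite ler_wpM2r.
- move=> y N yM Ay nN Nm; apply: le_trans (wm y Ay) _.
  apply: Gmono => //; apply: leq_trans nN.
  by rewrite /n' -addnA leq_addr.
move=> y [yM Ay nocov2 cost2].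
have [h1 h2 h3] := hd y Ay.
have subM : sub_node c ((n' + M)%N, K1 * (c ^ M)%:Z + y%:Z) (n', K1).
  rewrite /sub_node /= leq_addr /= addKn.
  have := @word_ancestor c hc K1 M 0 y (leq0n _); rewrite subn0 expn0 mulr1 => ->.
  by rewrite divn_small // addr0.
have subN := sub_node_trans subM sub1.
exists m, (d y); split.
- apply: leq_trans jm; rewrite /n' -addnA -[n.+1]addn1 leq_add2l; by rewrite (leq_trans _ (leq_addr _ _)) // (leq_trans _ k16).
- exact: sub_node_trans h1 subN.
- by apply: (lt_le_trans h2); case: (sub_node_bounds subN).
- exact: h3.
- by split.
Qed.

End Refine.

(** * The limit point *)

Section Limit.
Variables (R : realType) (c : nat).
Hypothesis hc : (1 < c)%N.
Variables (prob : 'I_c -> R) (t eta : R).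
Hypothesis t1 : 1 <= t.
Hypothesis prob01 : forall b, 0 < prob b < 1.
Hypothesis prob_sum : \sum_(b < c) prob b = 1.
Hypothesis eta01 : 0 < eta < 1 / 8.

Lemma floor_sub_node (x : R) (m n : nat) (K' K : int) : sub_node c (m, K') (n, K) ->
  Num.floor (x * c%:R ^+ m) = K' -> Num.floor (x * c%:R ^+ n) = K.
Proof.
move=> /andP[/= nm /eqP <-] <-.
by have := floor_divz hc x n (m - n); rewrite subnKC.
Qed.

Lemma sub_node_floor (x : R) (m n : nat) : (n <= m)%N ->
  sub_node c (m, Num.floor (x * c%:R ^+ m)) (n, Num.floor (x * c%:R ^+ n)).
Proof.
move=> nm; rewrite /sub_node /= nm /=.
by have := floor_divz hc x n (m - n); rewrite subnKC // => ->.
Qed.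

(* The right end points decrease strictly, so the common limit of the end
   points lies in all the half-open intervals. *)
Lemma nested_nodes_point (a : nat -> nat * int) :
  (forall i, sub_node c (a i.+1) (a i) /\
    ((a i.+1).2 + 1)%:~R / c%:R ^+ (a i.+1).1 < ((a i).2 + 1)%:~R / c%:R ^+ (a i).1 :> R) ->
  exists x : R, forall i, Num.floor (x * c%:R ^+ (a i).1) = (a i).2.
Proof.
move=> ha.
have cX n : 0 < c%:R ^+ n :> R by apply: baseX_gt0.
pose L i : R := (a i).2%:~R / c%:R ^+ (a i).1.
pose r i : R := ((a i).2 + 1)%:~R / c%:R ^+ (a i).1.
have Lr i : L i <= r i by rewrite /L /r ler_wpM2r ?invr_ge0 ?(ltW (cX _)) // ler_int lerDl.
have LS i : L i <= L i.+1.
  have [h _] := ha i; move: h; rewrite /L; case: (a i) (a i.+1) => [n K] [m K'].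
  by move=> /(sub_node_bounds R hc)[].
have rS i : r i.+1 <= r i by rewrite ltW //; case: (ha i).
have Lmono : {homo L : n m / (n <= m)%N >-> n <= m} by apply/nondecreasing_seqP.
have rmono : {homo r : n m / (n <= m)%N >-> m <= n} by apply/nonincreasing_seqP.
have Lub i j : L i <= r j.
  have [ij|/ltnW ji] := leqP i j.
    exact: le_trans (Lmono _ _ ij) (Lr j).
  exact: le_trans (Lr i) (rmono _ _ ji).
have hs : has_sup (range L).
  by split; [exists (L 0%N), 0%N|exists (r 0%N) => _ [i _ <-]].
exists (sup (range L)) => i; apply: floor_def.
rewrite -ler_pdivrMr // -ltr_pdivlMr //; apply/andP; split.
  by apply: (sup_upper_bound hs); exists i.
apply: (@le_lt_trans _ _ (r i.+1)); last by case: (ha i).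
by apply: ge_sup; [case: hs|move=> _ [j _ <-]].
Qed.

(** Otherwise [refine_node], iterated with [i = 0, 1, 2, ...], gives nested uncovered nodes around a
    point of all [V_i]. A member of generation [N] containing this point would cover the [N]-th
    node, whose generation is at least [N]. *)
Lemma node_cost_ge (G : nat -> R) (n0 : nat) (o : nat -> option (nat * int)) (n : nat) (K : int) :
  (forall N, 0 < G N) ->
  (forall N N', (n0 <= N)%N -> (N <= N')%N -> G N' <= G N) ->
  (forall N d, (n0 <= N)%N -> c%:R ^- d * G N <= G (N + d)%N) ->
  (exists N1, forall N, (N1 <= N)%N ->
    expR (- (entropy prob / t * (N%:R * ln c%:R)) + 3 * (N%:R * ln c%:R) `^ (eta + 7 / 8)) <= G N) ->
  (n0 <= n)%N ->
  (forall p, ~~ covers_node c (o p) (n, K)) ->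
  (forall x : R, (forall i, freq_ball prob t i x) -> Num.floor (x * c%:R ^+ n) = K ->
     exists p z, o p = Some z /\ Num.floor (x * c%:R ^+ z.1) = z.2) ->
  ((G n)%:E <= node_cost c G o (n, K))%E.
Proof.
move=> G0 Gmono Gd hG n0n nocov cover; rewrite leNgt; apply/negP => cost.
pose inv (z : nat * int) := [/\ (n0 <= z.1)%N, (forall p, ~~ covers_node c (o p) z) &
  (node_cost c G o z < (G z.1)%:E)%E].
pose step (i : nat) (z z' : nat * int) := [/\ (z.1 < z'.1)%N, sub_node c z' z,
    (z'.2 + 1)%:~R / c%:R ^+ z'.1 < (z.2 + 1)%:~R / c%:R ^+ z.1 :> R
    & forall x : R, Num.floor (x * c%:R ^+ z'.1) = z'.2 -> freq_ball prob t i x].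
have ex (y : nat * (nat * int)) : exists z', inv y.2 -> step y.1 y.2 z' /\ inv z'.
  case: y => i [m K'] /=.
  have [[/= n0m nc lt]|ni] := pselect (inv (m, K')); last by exists (0%N, 0).
  have [m' [K'' [h1 h2 h3 h4 [h5 h6]]]] := refine_node hc t1 prob01 prob_sum eta01 i G0
    (fun N N' mN => Gmono N N' (leq_trans n0m mN)) (fun d => Gd m d n0m) hG nc lt.
  exists (m', K'') => _; split; split => //=.
  by rewrite (leq_trans n0m) // ltnW.
have [f hf] := choice ex.
pose a := fix a i := if i is j.+1 then f (j, a j) else (n, K).
have ainv i : inv (a i).
  by elim: i => [|i IH]; [split|case: (hf (i, a i) IH)].
have astep i : step i (a i) (a i.+1) by case: (hf (i, a i) (ainv i)).
have [x hx] : exists x : R, forall i, Num.floor (x * c%:R ^+ (a i).1) = (a i).2.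
  by apply: nested_nodes_point => i; case: (astep i).
have ai i : (i <= (a i).1)%N.
  by elim: i => // i IH; apply: leq_ltn_trans IH _; case: (astep i).
have xF i : freq_ball prob t i x.
  by case: (astep i) => _ _ _; apply; exact: hx.
have [p [z [opz xz]]] := cover x xF (hx 0%N).
have [_ /(_ p)] := ainv z.1; rewrite opz /= => /negP nc _; apply: nc.
by have := sub_node_floor x (ai z.1); rewrite hx xz -!surjective_pairing.
Qed.

End Limit.

(** * Covers of an open set *)

Definition node_set {R : realType} (c : nat) (a : nat * int) : set R :=
  [set x | Num.floor (x * c%:R ^+ a.1) = a.2].

Definition onode_set {R : realType} (c : nat) (a : option (nat * int)) : set R :=
  if a is Some a' then node_set c a' else set0.

Section NodeSets.
Variables (R : realType) (c : nat).
Hypothesis hc : (1 < c)%N.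
Local Notation node_set := (@node_set R c).
Local Notation onode_set := (@onode_set R c).

Lemma adic_set_mem (j K : int) (x : R) :
  [set c%:R ^ (- j) * (K%:~R + u) | u in `[0, 1[] x <->
  K%:~R <= x * c%:R ^ j < (K + 1)%:~R.
Proof.
have c0 : c%:R != 0 :> R by rewrite lt0r_neq0 ?base_gt0.
have cj0 : 0 < c%:R ^ j :> R by rewrite exprz_gt0 // base_gt0.
rewrite intrD; split.
  move=> [u /=]; rewrite in_itv /= => /andP[u0 u1] <-.
  rewrite mulrAC -expfzDr // addNr expr0z mul1r.
  by rewrite lerDl u0 ltrD2l.
move=> /andP[h1 h2]; exists (x * c%:R ^ j - K%:~R).
  by rewrite /= in_itv /=; apply/andP; split; lra.
by rewrite addrC subrK mulrC -mulrA -expfzDr // subrr expr0z mulr1.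
Qed.

Lemma node_setE (N : nat) (K : int) :
  node_set (N, K) = [set c%:R ^ (- N%:Z) * (K%:~R + u) | u in `[0, 1[].
Proof.
apply/seteqP; split=> x.
  move=> xK; have <- : Num.floor (x * c%:R ^+ N) = K by exact: xK.
  by apply/adic_set_mem; exact: floor_itv.
by move=> /adic_set_mem h; exact: floor_def.
Qed.

Lemma diameter_scaled (s k : R) : 0 < s -> diameter [set s * (k + u) | u in `[0, 1[] = s.
Proof.
move=> s0; set A := [set _ | _ in _].
have A0 : A (s * (k + 0)) by exists 0 => //=; rewrite in_itv /= lexx ltr01.
have ub : ubound [set `|x.1 - x.2| | x in A `*` A] s.
  move=> z [[x y] [/= [u u01 <-] [v v01 <-]] <-].
  move: u01 v01; rewrite /= !in_itv /= => /andP[u0 u1] /andP[v0 v1].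
  rewrite -mulrBr normrM gtr0_norm // ger_pMr //.
  by rewrite opprD addrACA subrr add0r ler_norml; apply/andP; split; lra.
have ne : [set `|x.1 - x.2| | x in A `*` A] !=set0.
  by exists `|s * (k + 0) - s * (k + 0)|, (s * (k + 0), s * (k + 0)).
apply/eqP; rewrite eq_le; apply/andP; split; first exact: ge_sup.
rewrite leNgt; apply/negP => lt; rewrite -/(diameter A) in lt.
have hs : has_sup [set `|x.1 - x.2| | x in A `*` A] by split=> //; exists s.
have d0 : 0 <= diameter A.
  apply: (sup_upper_bound hs); exists (s * (k + 0), s * (k + 0)) => //=.
  by rewrite subrr normr0.
(* If the diameter were below [s], this point would be at distance [(diameter A + s) / 2] from the
   left end point, more than the diameter. *)
pose u := (diameter A / s + 1) / 2.
have ds : diameter A / s < 1 by rewrite ltr_pdivrMr // mul1r.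
have ds0 : 0 <= diameter A / s by rewrite divr_ge0 // ltW.
have Au : A (s * (k + u)) by exists u => //=; rewrite in_itv /= /u; apply/andP; split; lra.
have : `|s * (k + u) - s * (k + 0)| <= diameter A.
  by apply: (sup_upper_bound hs); exists (s * (k + u), s * (k + 0)).
have e : s * (k + u) - s * (k + 0) = (diameter A + s) / 2.
  by rewrite /u; field; rewrite gt_eqF.
rewrite e => h; have := le_trans (ler_norm _) h; lra.
Qed.

Lemma diameter_set0 : diameter (set0 : set R) = 0.
Proof.
rewrite /diameter (_ : [set _ | _ in _] = set0) ?sup0 //.
by apply/seteqP; split=> // x [[y z] [[]]].
Qed.

Lemma diameter_node (a : nat * int) : diameter (node_set a) = c%:R ^- a.1.
Proof.
case: a => N K; rewrite node_setE diameter_scaled; first by rewrite -exprnN.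
by rewrite exprz_gt0 // base_gt0.
Qed.

Lemma onode_set_adic (a : option (nat * int)) :
  (adic_interval c `|` [set set0]) (onode_set a).
Proof.
case: a => [[N K]|]; last by right.
by left; exists N%:Z, K; exact: node_setE.
Qed.

(** A length below [e <= 1] forces a nonnegative generation, so the encoding by nodes loses no
    member of a cover. *)
Lemma adic_node (l : set R) (e : R) : (adic_interval c `|` [set set0]) l ->
  diameter l < e -> e <= 1 ->
  exists a, l = onode_set a /\ (if a is Some z then c%:R ^- z.1 < e else true).
Proof.
move=> [[j [K ->]]|->] dl e1; last by exists None.
have cj0 : 0 < c%:R ^ (- j) :> R by rewrite exprz_gt0 // base_gt0.
rewrite diameter_scaled // in dl.
case: j cj0 dl => [N cj0 dl|N cj0 dl]; last first.
  exfalso; rewrite NegzE opprK in dl.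
  have : 1 <= c%:R ^+ N.+1 :> R by rewrite exprn_ege1 // ler1n ltnW.
  by move=> /le_lt_trans/(_ dl)/lt_le_trans/(_ e1); rewrite ltxx.
exists (Some (N, K)); split; first by rewrite -node_setE.
by move: dl; rewrite exprnN.
Qed.

Lemma node_set_sub (a b : nat * int) : sub_node c a b -> node_set a `<=` node_set b.
Proof.
case: a b => [m K'] [n K] ab x /= ax.
exact: (@floor_sub_node R c hc x m n K' K ab ax).
Qed.

(* The maximal nodes of an open set partition it. *)
Definition maximal_node (U : set R) (n0 : nat) (a : nat * int) : Prop :=
  [/\ (n0 <= a.1)%N, node_set a `<=` U &
    forall b, sub_node c a b -> (n0 <= b.1)%N -> (b.1 < a.1)%N -> ~ (node_set b `<=` U)].

Lemma maximal_node_exists (U : set R) (n0 : nat) (x : R) : open U -> U x ->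
  exists2 a, maximal_node U n0 a & node_set a x.
Proof.
move=> oU Ux.
have /nbhs_ballP[e /= e0 eU] : nbhs x U by apply: open_nbhs_nbhs.
have := @cvg_baseVX R c hc => /cvgr_lt/(_ _ e0)[N1 _ hN1].
pose nd N : nat * int := (N, Num.floor (x * c%:R ^+ N)).
pose good N := (n0 <= N)%N && `[< node_set (nd N) `<=` U >].
have ex : exists N, good N.
  exists (n0 + N1)%N; rewrite /good leq_addr /=; apply/asboolP => y /= yx.
  apply: eU; rewrite -ball_normE /=.
  have hN := hN1 (n0 + N1)%N (leq_addl _ _).
  have cN0 : 0 < c%:R ^+ (n0 + N1) :> R by apply: baseX_gt0.
  apply: (lt_trans _ hN).
  have /andP[g1 g2] := floor_itv (x * c%:R ^+ (n0 + N1)).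
  have /andP[g3 g4] := floor_itv (y * c%:R ^+ (n0 + N1)).
  rewrite yx in g3 g4; rewrite intrD in g2 g4.
  rewrite -[(c%:R ^+ _)^-1]mul1r ltr_pdivlMr // -[X in _ * X]gtr0_norm // -normrM mulrBl.
  by rewrite ltr_norml; apply/andP; split; lra.
case: (ex_minnP ex) => N /andP[n0N /asboolP NU] Nmin.
exists (nd N) => //; split=> // b ab n0b bN bU.
have : good b.1.
  rewrite /good n0b /=; apply/asboolP.
  have -> : nd b.1 = b => //.
  have := floor_sub_node hc (x := x) (m := N) (n := b.1) (K := b.2).
  rewrite -surjective_pairing => h; rewrite /nd (h _ ab) //.
  by rewrite -surjective_pairing.
by move=> /Nmin; rewrite leqNgt bN.
Qed.

Lemma maximal_node_uniq (U : set R) (n0 : nat) (a b : nat * int) :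
  maximal_node U n0 a -> maximal_node U n0 b -> sub_node c a b -> a = b.
Proof.
move=> [n0a aU amax] [n0b bU bmax] ab.
have /andP[ba _] := ab.
apply: (sub_node_eq ab); apply/eqP; rewrite eqn_leq ba andbT leqNgt.
by apply/negP => lt; exact: amax ab n0b lt bU.
Qed.

(** Each [q] lies in exactly one class of [kappa], so exchanging the two sums charges [w q] once. *)
Lemma nneseries_regroup (w w' : nat -> R) (kappa : nat -> nat) :
  (forall q, 0 <= w q) -> (forall p, 0 <= w' p) ->
  (forall p, ((w' p)%:E <= \sum_(0 <= q <oo) (if kappa q == p then w q else 0)%:E)%E) ->
  (\sum_(0 <= p <oo) (w' p)%:E <= \sum_(0 <= q <oo) (w q)%:E)%E.
Proof.
move=> w0 w'0 h.
apply: (@le_trans _ _ (\sum_(0 <= p <oo) \sum_(0 <= q <oo) (if kappa q == p then w q else 0)%:E)%E).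
  by apply: lee_nneseries => [p _|p _]; [rewrite lee_fin|exact: h].
rewrite nneseries_interchange; last by move=> p q; rewrite lee_fin; case: ifP.
apply: lee_nneseries => [q _ _|q _].
  by apply: nneseries_ge0 => p _ _; rewrite lee_fin; case: ifP.
rewrite (@nneseriesD1 _ _ (kappa q)) //; last by move=> p _; rewrite lee_fin; case: ifP.
rewrite eqxx eseries0 ?adde0 // => p _ /andP[_ pk].
by rewrite eq_sym (negbTE pk).
Qed.

(* Replace, inside every maximal node that is not covered by a single interval,
   all the intervals of the cover by the node itself; by [node_cost_ge] this
   does not increase the cost. *)
Lemma cover_maximal_nodes (G : nat -> R) (n0 : nat) (F U : set R)
    (o : nat -> option (nat * int)) :
  (forall N, 0 < G N) -> open U ->
  (forall n K, (n0 <= n)%N -> (forall p, ~~ covers_node c (o p) (n, K)) ->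
     (F `&` node_set (n, K) `<=` \bigcup_p onode_set (o p)) ->
     ((G n)%:E <= node_cost c G o (n, K))%E) ->
  F `&` U `<=` \bigcup_p onode_set (o p) ->
  exists o', [/\ U `<=` \bigcup_p onode_set (o' p),
    forall p z, o' p = Some z -> (n0 <= z.1)%N \/ o p = Some z
    & (\sum_(0 <= p <oo) (node_wt G (o' p))%:E <= \sum_(0 <= p <oo) (node_wt G (o p))%:E)%E].
Proof.
move=> G0 oU key FU.
pose bad (a : nat * int) := maximal_node U n0 a /\ forall p, ~~ covers_node c (o p) a.
have exr a : exists p0, (exists p, osub_node c (o p) a) -> osub_node c (o p0) a.
  by have [[p h]|no] := pselect (exists p, osub_node c (o p) a); [exists p|exists 0%N].
have [rep hrep] := choice exr.
have exc p : exists s : option (nat * int), if s is Some a then bad a /\ osub_node c (o p) a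
    else forall a, bad a -> ~~ osub_node c (o p) a.
  have [[a [ba h]]|no] := pselect (exists a, bad a /\ osub_node c (o p) a).
    by exists (Some a).
  by exists None => a ba; apply/negP => h; apply: no; exists a.
have [cl hcl] := choice exc.
have clE p a : bad a -> osub_node c (o p) a -> cl p = Some a.
  move=> ba pa; have := hcl p; case: (cl p) => [b [bb pb]|h]; last first.
    by have := h a ba; rewrite pa.
  congr Some; case: (o p) pa pb => //= z za zb.
  case: ba bb => [ma _] [mb _].
  have /orP[ab|ba] := sub_node_comparable za zb.
    by rewrite (maximal_node_uniq ma mb ab).
  exact: maximal_node_uniq mb ma ba.
(* For each bad node [a] the index [rep a] carries the whole node and the other members inside it
   become [None]. [kappa] groups these members at [rep a], so that their total cost pays for the
   node. *)
pose o' p := if cl p is Some a then (if rep a == p then Some a else None) else o p.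
pose kappa q := if cl q is Some a then rep a else q.
have wt0 a : 0 <= node_wt G a by case: a => //= z; exact: ltW.
have keya a : bad a -> ((G a.1)%:E <= node_cost c G o a)%E.
  move=> [[n0a aU amax] nc]; case: a n0a aU nc {amax} => n K n0a aU nc.
  apply: key => // x [Fx ax]; apply: FU; split=> //; exact: aU.
have repa a : bad a -> osub_node c (o (rep a)) a.
  move=> ba; apply: hrep; apply: contrapT => no.
  (* Without a member inside [a] its cost would be 0, against [keya] and the positivity of [G]. *)
  have := keya a ba; rewrite /node_cost eseries0.
    by rewrite lee_fin leNgt G0.
  by move=> p _ _; case: ifP => // h; exfalso; apply: no; exists p.
exists o'; split.
- move=> x Ux; have [a ma ax] := maximal_node_exists n0 oU Ux.
  have [[p cov]|nc] := pselect (exists p, covers_node c (o p) a); last first.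
    have ba : bad a by split=> // p; apply/negP => h; apply: nc; exists p.
    exists (rep a) => //; rewrite /o' (clE _ a ba (repa a ba)) eqxx.
    exact: ax.
  (* A member containing the maximal node [a] is kept: if it lay in a bad node, that node would
     equal [a] and be covered. *)
  exists p => //; rewrite /o'; have := hcl p; case: (cl p) => [b [[mb nb] pb]|_].
    move: cov (nb p) pb; case: (o p) => //= z az nbz zb.
    have := maximal_node_uniq ma mb (sub_node_trans az zb) => e.
    by rewrite -e az in nbz.
  by move: cov; case: (o p) => //= z az; exact: node_set_sub az _ ax.
- move=> p z; rewrite /o'; have := hcl p; case: (cl p) => [b [[[nb _ _] _] _]|_ ->]; last by right.
  by case: ifP => // _ [<-]; left.
- apply: (@nneseries_regroup _ _ kappa) => // p; rewrite /o'.
  have := hcl p; case E: (cl p) => [a|] ha.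
    case: eqP => [ra|_] /=; last first.
      by apply: nneseries_ge0 => q _ _; rewrite lee_fin; case: ifP.
    case: ha => ba pa; apply: (le_trans (keya a ba)).
    apply: lee_nneseries => [q _|q _].
      by rewrite lee_fin; case: ifP.
    rewrite lee_fin; case: ifP => [qa|_]; last by case: ifP.
    by rewrite /kappa (clE q a ba qa) ra eqxx.
  rewrite (@nneseriesD1 _ _ p) //; last by move=> q _; rewrite lee_fin; case: ifP.
  rewrite {1}/kappa E eqxx leeDl //.
  by apply: nneseries_ge0 => q _ _; rewrite lee_fin; case: ifP.
Qed.

End NodeSets.

(** * The approximation set *)

Section FreqBall.
Variables (R : realType) (c : nat) (prob : 'I_c -> R) (t : R).

Lemma open_freq_ball (i : nat) : open (freq_ball prob t i).
Proof.
pose Q (pq : int * nat) := [/\ (0 < pq.2)%N && coprimez pq.1 pq.2%:Z, (i <= pq.2)%N &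
   forall b : 'I_c, `|digit_freq c b (Num.truncn (2 * log_base c (pq.2%:R : R)))
            (pq.1%:~R / pq.2%:R : R) - prob b| < i.+1%:R^-1].
have -> : freq_ball prob t i = \bigcup_(pq in Q)
    ball (pq.1%:~R / pq.2%:R : R) (pq.2%:R `^ (- (2 * t))).
  apply/seteqP; split=> x.
    move=> [p [q [h1 h2 h3 h4]]]; exists (p, q) => //.
    by rewrite -ball_normE /= distrC.
  move=> [[p q] [h1 h2 h3]]; rewrite -ball_normE /= distrC => h4.
  by exists p, q.
by apply: bigcup_open => pq _; exact: ball_open.
Qed.

Lemma freq_ball_approx : \bigcap_i freq_ball prob t i `<=` approx_freq_set prob t.
Proof.
move=> x hx.
have ex (n : nat) : exists pq : int * nat, [/\ (0 < pq.2)%N && coprimez pq.1 pq.2%:Z, (n <= pq.2)%N,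
    forall b : 'I_c, `|digit_freq c b (Num.truncn (2 * log_base c (pq.2%:R : R)))
            (pq.1%:~R / pq.2%:R : R) - prob b| < n.+1%:R^-1
    & `|x - pq.1%:~R / pq.2%:R| < pq.2%:R `^ (- (2 * t))].
  by have [p [q h]] := hx n I; exists (p, q).
have [f hf] := choice ex.
exists (fun n => (f n).1), (fun n => (f n).2); split.
- by move=> n; case: (hf n).
- apply/cvgnyPge => A; exists A => // n /= An.
  by case: (hf n) => _ h _ _; exact: leq_trans h.
- by move=> n; apply: ltW; case: (hf n).
- move=> b; apply/cvgrPdist_lt => e e0.
  near=> n; rewrite distrC.
  have [_ _ h _] := hf n; apply: lt_trans (h b) _.
  by near: n; exact: near_infty_natSinv_lt (PosNum e0).
Unshelve. all: by end_near. Qed.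

End FreqBall.

(** * Net content of the limsup set inside an open set *)

Theorem corollary3 (R : realType) (t : R) (ht : 1 <= t) (c : nat) (hc : (2 <= c)%N)
    (prob : 'I_c -> R) (prob_bounds : forall b, 0 < prob b < 1)
    (prob_sum : \sum_(b < c) prob b = 1)
    (eta : R) (heta : 0 < eta < 1 / 8) :
  exists2 F : set R,
    large_intersection c
      (hgauge (entropy prob / t) (fun r => 3 * f_eta eta r)) F
    & F `<=` approx_freq_set prob t.
Proof.
exists (\bigcap_i freq_ball prob t i); last exact: freq_ball_approx.
split; first by exists (freq_ball prob t) => //; exact: open_freq_ball.
move=> g gg gh U oU.
set F := \bigcap_i freq_ball prob t i.
have cX a : 0 < c%:R ^+ a :> R by apply: baseX_gt0.
have cV a : 0 < c%:R ^- a :> R by rewrite invr_gt0.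
apply/eqP; rewrite eq_le; apply/andP; split.
  apply: ereal_inf_le_tmp => _ [l [l1 l2 l3] <-]; exists l => //; split=> // x [_ Ux].
  exact: l2.
apply: le_ereal_inf_tmp => _ [l [l1 l2 l3] <-].
have r0 := gauge_radius_gt0 gg; have r1 := gauge_radius_le1 g.
have ex : exists N : nat, c%:R ^- N < gauge_radius g.
  have := @cvg_baseVX R c hc => /cvgr_lt/(_ _ r0)[N _ hN].
  by exists N; apply: hN => /=.
(* By minimality, a node is short enough for a cover exactly when its generation is at least
   [n0]. *)
case: (ex_minnP ex) => n0 n0r n0min.
have cmono N N' : (N <= N')%N -> c%:R ^- N' <= c%:R ^- N :> R.
  by move=> NN'; rewrite lef_pV2 ?posrE // ler_weXn2l // ler1n ltnW.
have n0lt N : (n0 <= N)%N -> c%:R ^- N < gauge_radius g.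
  by move=> n0N; apply: le_lt_trans n0r; exact: cmono.
case: (choice (fun p => adic_node hc (l1 p) (l3 p) r1)) => o ho.
(* The value 1 below [n0] keeps [G] positive; the nodes of the cover all have generation at least
   [n0]. *)
pose G N : R := if (n0 <= N)%N then g (c%:R ^- N) else 1.
have G0 N : 0 < G N.
  by rewrite /G; case: ifP => // n0N; exact: (gauge_gt0 gg (cV _) (n0lt _ n0N)).
have Gmono N N' : (n0 <= N)%N -> (N <= N')%N -> G N' <= G N.
  move=> n0N NN'; rewrite /G n0N (leq_trans n0N NN').
  exact: (gauge_nondecreasing gg (ltW (cV _)) (cmono _ _ NN') (n0lt _ n0N)).
have Gd N d : (n0 <= N)%N -> c%:R ^- d * G N <= G (N + d)%N.
  move=> n0N; rewrite /G n0N (leq_trans n0N (leq_addr _ _)).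
  have := gauge_ratio_nonincreasing gg (cV (N + d)%N) (cmono _ _ (leq_addr d N)) (n0lt _ n0N).
  rewrite !invrK => h.
  rewrite mulrC ler_pdivrMr // -(ler_pM2r (cX N)) -mulrA -exprD [(d + N)%N]addnC.
  exact: h.
have hG : exists N1, forall N, (N1 <= N)%N ->
    expR (- (entropy prob / t * (N%:R * ln c%:R)) + 3 * (N%:R * ln c%:R) `^ (eta + 7 / 8)) <= G N.
  have h0 N : (0 < N)%N -> 0 < hgauge (entropy prob / t) (fun r => 3 * f_eta eta r) (c%:R ^- N).
    by move=> N0; rewrite hgaugeE // expR_gt0.
  have [N1 hN1] := gauge_prec_ge hc gh h0.
  exists (n0 + N1).+1 => N hN.
  have N0 : (0 < N)%N by apply: leq_ltn_trans hN.
  rewrite -hgaugeE // /G ifT; last by rewrite (leq_trans (leq_addr N1 _)) // ltnW.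
  by apply: hN1; rewrite (leq_trans (leq_addl n0 _)) // ltnW.
have wtE p : node_wt G (o p) = g (diameter (l p)).
  have [-> ] := ho p; case: (o p) => [z|] /=; last by rewrite diameter_set0; case: gg.
  by move=> /n0min n0z; rewrite diameter_node // /G n0z.
(* The given cover of the intersection is turned into a cover of all of [U] that costs no more; its
   nodes still have generation at least [n0], so it is admissible for the net content of [U]. *)
have [] := @cover_maximal_nodes R c hc G n0 F U o G0 oU.
- move=> n K n0n nc cov.
  apply: (node_cost_ge hc ht prob_bounds prob_sum heta G0 Gmono Gd hG n0n nc) => x Fx xK.
  have Fn : (F `&` node_set c (n, K)) x by split=> // i _; exact: Fx.
  have [p _] := cov x Fn.
  by case E : (o p) => [z|//] xz; exists p, z.
- move=> x /l2[p _ lx]; exists p => //.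
  by have [<- _] := ho p.
move=> o' [UU' o'n o'c].
have o'0 p z : o' p = Some z -> (n0 <= z.1)%N.
  move=> /o'n[//|opz]; apply: n0min.
  by have [_] := ho p; rewrite opz.
apply: ge_ereal_inf; exists (\sum_(0 <= p <oo) (node_wt G (o' p))%:E)%E; last first.
  apply: (le_trans o'c); rewrite le_eqVlt; apply/orP; left; apply/eqP.
  by apply: eq_eseriesr => p _; rewrite wtE.
exists (fun p => onode_set c (o' p)).
  split=> // p; first exact: onode_set_adic.
  case E : (o' p) => [z|] /=; last by rewrite diameter_set0.
  by rewrite diameter_node // n0lt // (o'0 _ _ E).
apply: eq_eseriesr => p _; case E : (o' p) => [z|] /=; last first.
  by rewrite diameter_set0; case: gg => ->.
by rewrite diameter_node // /G (o'0 _ _ E).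
Qed.
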